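(* Let $R$ be a commutative ring with identity. If the polynomial ring $R[X]$ in one indeterminate $X$ over $R$ is coherent, then $$\mathrm{G\text{-}wdim}(R[X])=\mathrm{G\text{-}wdim}(R)+1.$$
   Context: All rings are commutative with identity and all modules are unital. A ring is coherent if each of its finitely generated ideals is finitely presented. An $R$-module $M$ is Gorenstein flat if there is an exact sequence of flat $R$-modules $\mathbf F=\cdots\to F_1\to F_0\to F^0\to F^1\to\cdots$ with $M\cong \mathrm{Im}(F_0\to F^0)$ such that $I\otimes_R\mathbf F$ is exact for every injective $R$-module $I$. The Gorenstein flat dimension $\mathrm{Gfd}_R(M)$ of a nonzero module $M$ is the least integer $k\ge 0$ such that there is an exact sequence $0\to G_k\to\cdots\to G_0\to M\to 0$ with all $G_i$ Gorenstein flat ($\infty$ if no such $k$ exists); the zero module has dimension $-\infty$ by the usual convention. The Gorenstein weak dimension of $R$ is $\mathrm{G\text{-}wdim}(R)=\sup\{\mathrm{Gfd}_R(M)\mid M \text{ an } R\text{-module}\}$, which may be infinite. *)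

(* Defs.v *)
From HB Require Import structures.
From mathcomp Require Import all_boot all_order all_algebra.
From mathcomp Require Import all_classical constructive_ereal.
From mathcomp Require Import freeg.

Set Implicit Arguments.
Unset Strict Implicit.
Unset Printing Implicit Defensive.

Import Order.TTheory GRing.Theory Num.Theory.
Local Open Scope ring_scope.
Local Open Scope quotient_scope.

(* Commutative rings are [comPzRingType]s, so that the zero ring is allowed. *)

Definition surj (A B : Type) (f : A -> B) : Prop := forall y, exists x, f x = y.

(* Exactness at [B] of A --f--> B --g--> C. *)
Definition exact_at (A B : Type) (C : zmodType) (f : A -> B) (g : B -> C) : Prop :=
  forall y, g y = 0 <-> exists x, f x = y.

Section Submodule.
Variables (R : comPzRingType) (V : lmodType R) (S : submodClosed V).

Definition submod : Type := {x : V | x \in S}.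

HB.instance Definition _ := [isSub of submod for @sval _ _].
HB.instance Definition _ := [Choice of submod by <:].
HB.instance Definition _ := [SubChoice_isSubLmodule of submod by <:].

End Submodule.

Section Coherent.
Variable R : comPzRingType.

Definition finitely_generated (M : lmodType R) : Prop :=
  exists (n : nat) (g : {linear 'rV[R]_n -> M}), surj g.

Definition finitely_presented (M : lmodType R) : Prop :=
  exists (m n : nat) (f : {linear 'rV[R]_m -> 'rV[R]_n})
         (g : {linear 'rV[R]_n -> M}),
    exact_at f g /\ surj g.

(* The ideals of [R] are the submodules of the regular module [R^o]. *)
Definition coherent : Prop :=
  forall I : submodClosed (R^o : lmodType R),
    finitely_generated (submod I) -> finitely_presented (submod I).

End Coherent.

(* The tensor product is the free abelian group on M x N modulo the subgroup
   generated by the relations of biadditivity and R-balancedness. *)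
Section Tensor.
Variables (R : comPzRingType) (M N : lmodType R).

Notation freeMN := {freeg (M * N)%type / int}.

Inductive tensor_rel : freeMN -> Prop :=
| tensor_rel0 : tensor_rel 0
| tensor_relB x y : tensor_rel x -> tensor_rel y -> tensor_rel (x - y)
| tensor_relDl m1 m2 n :
    tensor_rel (<< (m1 + m2, n) >> - << (m1, n) >> - << (m2, n) >>)
| tensor_relDr m n1 n2 :
    tensor_rel (<< (m, n1 + n2) >> - << (m, n1) >> - << (m, n2) >>)
| tensor_relZ (r : R) m n :
    tensor_rel (<< (r *: m, n) >> - << (m, r *: n) >>).

Definition tensor_relb : {pred freeMN} := fun x => `[< tensor_rel x >].

Fact tensor_rel_zmod_closed : zmod_closed tensor_relb.
Proof.
split; first exact/asboolP/tensor_rel0.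
by move=> x y /asboolP hx /asboolP hy; apply/asboolP/tensor_relB.
Qed.

HB.instance Definition _ :=
  GRing.isZmodClosed.Build _ tensor_relb tensor_rel_zmod_closed.

Definition tensor : Type := Quotient.quot tensor_relb.

HB.instance Definition _ := GRing.Zmodule.on tensor.

Definition tens (m : M) (n : N) : tensor := \pi_(Quotient.quot tensor_relb) << (m, n) >>.

Lemma pi_tensor_eq (x y : freeMN) : tensor_rel (x - y) ->
  \pi_(Quotient.quot tensor_relb) x = \pi_(Quotient.quot tensor_relb) y.
Proof. by move=> h; apply/eqP; rewrite -Quotient.idealrBE; apply/asboolP. Qed.

Lemma tensDl m1 m2 n : tens (m1 + m2) n = tens m1 n + tens m2 n.
Proof.
rewrite /tens -raddfD; apply: pi_tensor_eq; rewrite opprD addrA.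
exact: tensor_relDl.
Qed.

Lemma tensDr m n1 n2 : tens m (n1 + n2) = tens m n1 + tens m n2.
Proof.
rewrite /tens -raddfD; apply: pi_tensor_eq; rewrite opprD addrA.
exact: tensor_relDr.
Qed.

Lemma tensZ r m n : tens (r *: m) n = tens m (r *: n).
Proof. exact/pi_tensor_eq/tensor_relZ. Qed.

Definition balanced (Z : zmodType) (b : M -> N -> Z) : Prop :=
  [/\ forall m1 m2 n, b (m1 + m2) n = b m1 n + b m2 n,
      forall m n1 n2, b m (n1 + n2) = b m n1 + b m n2 &
      forall r m n, b (r *: m) n = b m (r *: n)].

(* Only meaningful for balanced [b], see [tensor_liftE] and [tensor_liftB]. *)
Definition tensor_lift (Z : zmodType) (b : M -> N -> Z) (t : tensor) : Z :=
  fglift (fun p => b p.1 p.2 : zmodule Z) (repr t).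

Section Lift.
Variables (Z : zmodType) (b : M -> N -> Z) (hb : balanced b).

Let L (x : freeMN) : zmodule Z := fglift (fun p => b p.1 p.2 : zmodule Z) x.

Let LB x y : L (x - y) = L x - L y.
Proof. exact: lift_is_additive. Qed.

Let LU p : L << p >> = b p.1 p.2.
Proof. by rewrite /L liftU scale1r. Qed.

Let L_rel x : tensor_rel x -> L x = 0.
Proof.
case: hb => hl hr hz.
elim=> [|{}x y _ hx _ hy|m1 m2 n|m n1 n2|r m n]; rewrite ?LB ?LU /=.
- by rewrite -(subrr 0) LB subrr.
- by rewrite hx hy subrr.
- by rewrite hl addrAC addrK subrr.
- by rewrite hr addrAC addrK subrr.
- by rewrite hz subrr.
Qed.

Let L_pi x : tensor_lift b (\pi_(Quotient.quot tensor_relb) x) = L x.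
Proof.
rewrite /tensor_lift -/(L _); apply/eqP; rewrite -subr_eq0 -LB.
apply/eqP/L_rel/asboolP; rewrite -/(tensor_relb _).
have := Quotient.idealrBE (@tensor_relb) (repr (\pi_(Quotient.quot tensor_relb) x)) x.
by rewrite reprK eqxx.
Qed.

Lemma tensor_liftE m n : tensor_lift b (tens m n) = b m n.
Proof. by rewrite /tens L_pi LU. Qed.

Lemma tensor_liftB s t : tensor_lift b (s - t) = tensor_lift b s - tensor_lift b t.
Proof.
elim/quotP: s => s _; elim/quotP: t => t _.
by rewrite -raddfB !L_pi LB.
Qed.

End Lift.

Lemma tensor_ind (P : tensor -> Prop) :
  (forall m n, P (tens m n)) -> (forall s t, P s -> P t -> P (s - t)) ->
  forall t, P t.
Proof.
move=> PU PB t.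
have P0 : P 0 by rewrite -(subrr (tens 0 0)); apply: PB.
have PN s : P s -> P (- s) by move=> Ps; rewrite -sub0r; apply: PB.
have PD s u : P s -> P u -> P (s + u).
  by move=> Ps Pu; rewrite -[u]opprK; apply: PB => //; apply: PN.
elim/quotP: t => x _; rewrite -(freeg_sumE x).
rewrite raddf_sum; elim/big_ind: _ => // p _.
case: p => m n; move: (coeff _ _) => c.
have -> : << c *g (m, n) >> = << (m, n) >> *~ c :> freeMN by rewrite freegU_mulz intz.
rewrite raddfMz -/(tens m n).
have Pn k : P (tens m n *+ k) by elim: k => [|k IH] //; rewrite mulrS; apply: PD.
by case: c => k; [apply: Pn | rewrite NegzE mulrNz; apply/PN/Pn].
Qed.

Lemma tensor_ext (Z : zmodType) (f g : tensor -> Z) :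
  (forall s t, f (s - t) = f s - f t) -> (forall s t, g (s - t) = g s - g t) ->
  (forall m n, f (tens m n) = g (tens m n)) -> f =1 g.
Proof.
by move=> fB gB e; elim/tensor_ind => // s t hs ht; rewrite fB gB hs ht.
Qed.

End Tensor.

Section TensorModule.
Variables (R : comPzRingType) (M N : lmodType R).

Definition tensor_scale (r : R) : tensor M N -> tensor M N :=
  tensor_lift (fun m n => tens (r *: m) n).

Let scale_balanced r : balanced (fun (m : M) (n : N) => tens (r *: m) n).
Proof.
split=> *; rewrite ?scalerDr ?tensDl ?tensDr //.
by rewrite -tensZ !scalerA mulrC.
Qed.

Lemma tensor_scaleE r m n : tensor_scale r (tens m n) = tens (r *: m) n.
Proof. exact: tensor_liftE. Qed.

Let scaleB r s t : tensor_scale r (s - t) = tensor_scale r s - tensor_scale r t.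
Proof. exact: tensor_liftB. Qed.

Fact tensor_scaleA a b t :
  tensor_scale a (tensor_scale b t) = tensor_scale (a * b) t.
Proof.
move: t; apply: tensor_ext => [s t|s t|m n]; rewrite ?scaleB //.
by rewrite !tensor_scaleE scalerA.
Qed.

Fact tensor_scale1 : left_id 1 tensor_scale.
Proof.
by apply: tensor_ext => [s t|s t|m n]; rewrite ?scaleB // tensor_scaleE scale1r.
Qed.

Fact tensor_scaleDr : right_distributive tensor_scale +%R.
Proof.
move=> r s t.
have scaleN u : tensor_scale r (- u) = - tensor_scale r u.
  by rewrite -sub0r scaleB -[X in tensor_scale r X](subrr 0) scaleB subrr sub0r.
by rewrite -[t in LHS]opprK scaleB scaleN opprK.
Qed.

Fact tensor_scaleDl t : {morph tensor_scale^~ t : a b / a + b}.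
Proof.
move=> a b; move: t; apply: tensor_ext => [s t|s t|m n] /=; rewrite ?scaleB //.
  by rewrite opprD addrACA.
by rewrite !tensor_scaleE scalerDl tensDl.
Qed.

HB.instance Definition _ := GRing.Zmodule_isLmodule.Build R (tensor M N)
  tensor_scaleA tensor_scale1 tensor_scaleDr tensor_scaleDl.

Lemma tensZl r m n : r *: (tens m n : tensor M N) = tens (r *: m) n.
Proof. exact: tensor_scaleE. Qed.

End TensorModule.

Section TensorMap.
Variables (R : comPzRingType) (M N N' : lmodType R) (f : {linear N -> N'}).

(* M (x) f, see [tensor_mapE]. *)
Definition tensor_map : tensor M N -> tensor M N' :=
  tensor_lift (fun m n => tens m (f n)).

Let map_balanced : balanced (fun (m : M) (n : N) => tens m (f n)).
Proof. by split=> *; rewrite ?tensDl ?linearD ?tensDr // linearZ tensZ. Qed.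

Lemma tensor_mapE m n : tensor_map (tens m n) = tens m (f n).
Proof. exact: tensor_liftE. Qed.

Fact tensor_map_zmod_morphism : zmod_morphism tensor_map.
Proof. exact: tensor_liftB. Qed.

HB.instance Definition _ := GRing.isZmodMorphism.Build _ _ tensor_map
  tensor_map_zmod_morphism.

Fact tensor_map_scalable : scalable tensor_map.
Proof.
move=> r; apply: tensor_ext => [s t|s t|m n].
- by rewrite scalerBr raddfB.
- by rewrite raddfB scalerBr.
- by rewrite tensZl !tensor_mapE tensZl.
Qed.

HB.instance Definition _ := GRing.isScalable.Build _ _ _ _ tensor_map
  tensor_map_scalable.

End TensorMap.

Arguments tensor_map {R} M {N N'} f.

Section Gorenstein.
Variable R : comPzRingType.

Definition flat (M : lmodType R) : Prop :=
  forall (A B : lmodType R) (f : {linear A -> B}),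
    injective f -> injective (tensor_map M f).

Definition injective_module (I : lmodType R) : Prop :=
  forall (A B : lmodType R) (i : {linear A -> B}) (f : {linear A -> I}),
    injective i -> exists g : {linear B -> I}, forall a, g (i a) = f a.

(* The two-sided sequence is indexed homologically by [int]:
   F_n is [F n] and F^n is [F (- n - 1)], so that F_0 -> F^0 is [d (-1)]. *)
Definition gorenstein_flat (M : lmodType R) : Prop :=
  exists (F : int -> lmodType R) (d : forall n : int, {linear F (n + 1) -> F n}),
    [/\ forall n, flat (F n),
        forall n, exact_at (d (n + 1)) (d n),
        exists i : {linear M -> F (-1)},
          injective i /\ range i = range (d (-1)) &
        forall I : lmodType R, injective_module I ->
          forall n, exact_at (tensor_map I (d (n + 1))) (tensor_map I (d n))].

Definition is_zero_module (M : lmodType R) : Prop := forall x : M, x = 0.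

(* 0 -> G k -> ... -> G 0 -> M -> 0, continued by zero modules above [k]. *)
Definition gorenstein_flat_resolution (M : lmodType R) (k : nat) : Prop :=
  exists (G : nat -> lmodType R) (d : forall i, {linear G i.+1 -> G i})
         (e : {linear G 0%N -> M}),
    [/\ forall i, (i <= k)%N -> gorenstein_flat (G i),
        forall i, (k < i)%N -> is_zero_module (G i),
        surj e,
        exact_at (d 0%N) e &
        forall i, exact_at (d i.+1) (d i)].

(* Dimensions live in [\bar int], where every set has a supremum and an
   infimum. *)
Definition Gfd (M : lmodType R) : \bar int :=
  if `[< is_zero_module M >] then -oo%E
  else infimum +oo%E
    [set k%:Z%:E | k in [set k : nat | gorenstein_flat_resolution M k]].

Definition Gwdim : \bar int :=
  supremum -oo%E [set x | exists M : lmodType R, x = Gfd M].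

End Gorenstein.

Section Polynomials.

Definition nontrivial_ring (R : comPzRingType) (h : 1 != 0 :> R) : comNzRingType :=
  HB.pack_for comNzRingType (GRing.ComPzRing.sort R) (GRing.ComPzRing.class R)
    (GRing.PzSemiRing_isNonZero.Build R h).

(* [{poly R}] is only available for a nontrivial [R]; when 1 = 0 in [R], the
   polynomial ring R[X] is again the zero ring, hence is [R] itself. *)
Definition polynomial_ring (R : comPzRingType) : comPzRingType :=
  match pselect (1 != 0 :> R) with
  | left h => {poly nontrivial_ring h}
  | right _ => R
  end.

Lemma nontrivial_ringK (R : comPzRingType) (h : 1 != 0 :> R) :
  (nontrivial_ring h : comPzRingType) = R.
Proof. by case: R h. Qed.

Lemma nontrivial_ringE (R : comNzRingType) (h : 1 != 0 :> R) :
  nontrivial_ring h = R.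
Proof.
case: R h => T c h; rewrite /nontrivial_ring /=; congr GRing.ComNzRing.Pack.
case: c h => ? ? ? ? ? ? ? ? ? ? [k] ? h /=; congr GRing.ComNzRing.Class.
congr GRing.PzSemiRing_isNonZero.Axioms_; exact: bool_irrelevance.
Qed.

Lemma polynomial_ringE (R : comNzRingType) : polynomial_ring R = {poly R}.
Proof.
rewrite /polynomial_ring; case: pselect => [h|]; last by rewrite oner_neq0.
by rewrite nontrivial_ringE.
Qed.

End Polynomials.

(* Main.v *)
(* For a nontrivial commutative ring R, G-wdim(R) <= n iff every injective
   R-module has flat dimension at most n (after Emmanouil).  If Gfd(M) <= n for
   all M, then Tor_{n+1}(I, M) = 0 for I injective, since Tor_i(I, G) = 0 for G
   Gorenstein flat and i > 0.  Conversely, taking n-th syzygies of an injective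
   resolution of M gives an exact sequence of flat modules to the right of the
   n-th syzygy of M, to be spliced with a free resolution on the left; tensoring
   with an injective module, of finite flat dimension, preserves exactness of a
   two-sided exact complex of flat modules.

   It remains to see that the supremum of the flat dimensions of the injectives
   grows by one from R to R[X].  An injective R[X]-module J is injective over R,
   and 0 -> M[X] -> M[X] -> M -> 0 gives the upper bound, because
   Tor^{R[X]}(J, M[X]) = Tor^R(J, M).  For the lower bound one takes
   J = Hom_R(R[X], I), an injective R[X]-module containing a copy of I killed by
   X: if Tor^{R[X]}_{m+1}(J, M) = 0 for the modules M with X M = 0, then X is
   injective on Tor^R_m(J, M), so that Tor^R_m(I, M) = 0.

   Only the vanishing of Tor enters, so Tor itself is never constructed:
   [tor1_zero M N] stands for Tor_1(M, N) = 0 and [tor1_zero (iter n Omega M) N],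
   with syzygies taken from the free cover on the underlying set, for
   Tor_{n+1}(M, N) = 0. *)
From HB Require Import structures.
From mathcomp Require Import all_boot all_order all_algebra.
From mathcomp Require Import all_classical constructive_ereal.
From mathcomp Require Import freeg.
Require Import Defs.

Set Implicit Arguments.
Unset Strict Implicit.
Unset Printing Implicit Defensive.

Import Order.TTheory GRing.Theory Num.Theory.
Local Open Scope ring_scope.
Local Open Scope quotient_scope.

(** * Modules and tensor products *)

Definition ses (A B : Type) (C : zmodType) (f : A -> B) (g : B -> C) : Prop :=
  [/\ injective f, exact_at f g & surj g].

Lemma raddf_inj0 (U V : zmodType) (f : {additive U -> V}) :
  (forall x, f x = 0 -> x = 0) -> injective f.
Proof.
move=> h x y e; apply/eqP; rewrite -subr_eq0; apply/eqP/h.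
by rewrite raddfB e subrr.
Qed.

(** * Kernels, images and cokernels of linear maps *)

Section KernelImageCokernel.
Variables (R : comPzRingType) (U V : lmodType R) (f : {linear U -> V}).

Definition kerb : {pred U} := fun x => f x == 0.

Fact kerb_submod_closed : submod_closed kerb.
Proof.
split; first by rewrite unfold_in linear0.
by move=> a u v /eqP hu /eqP hv; rewrite unfold_in linearP hu hv scaler0 addr0.
Qed.

HB.instance Definition _ := GRing.isSubmodClosed.Build R U kerb kerb_submod_closed.

Definition imb : {pred V} := fun y => `[< exists x, f x = y >].

Fact imb_submod_closed : submod_closed imb.
Proof.
split; first by apply/asboolP; exists 0; rewrite linear0.
move=> a u v /asboolP[x <-] /asboolP[y <-]; apply/asboolP.
by exists (a *: x + y); rewrite linearP.
Qed.

HB.instance Definition _ := GRing.isSubmodClosed.Build R V imb imb_submod_closed.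

End KernelImageCokernel.

Section QuotientModule.
Variables (R : comPzRingType) (V : lmodType R) (S : submodClosed V).

Definition quot_pred : {pred V} := fun x => x \in S.

Fact quot_pred_zmod_closed : zmod_closed quot_pred.
Proof.
split; first exact: rpred0.
move=> x y hx hy; rewrite unfold_in -scaleN1r.
by apply: rpredD; last apply: rpredZ.
Qed.

HB.instance Definition _ := GRing.isZmodClosed.Build V quot_pred quot_pred_zmod_closed.

Definition quotmod : Type := Quotient.quot quot_pred.

HB.instance Definition _ := GRing.Zmodule.on quotmod.

Definition qproj (x : V) : quotmod := \pi_(Quotient.quot quot_pred) x.

Lemma qproj_eq x y : qproj x = qproj y <-> x - y \in S.
Proof.
rewrite /qproj; split => [/eqP|].
  by rewrite -Quotient.idealrBE.
by move=> h; apply/eqP; rewrite -Quotient.idealrBE.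
Qed.

Lemma qproj_surj : surj qproj.
Proof. by move=> y; exists (repr y); rewrite /qproj reprK. Qed.

Fact qproj_zmod_morphism : zmod_morphism qproj.
Proof. by move=> x y; rewrite /qproj raddfB. Qed.

HB.instance Definition _ :=
  GRing.isZmodMorphism.Build _ _ qproj qproj_zmod_morphism.

Definition qscale (r : R) (x : quotmod) : quotmod := qproj (r *: repr x).

Lemma qscaleE r x : qscale r (qproj x) = qproj (r *: x).
Proof.
apply/qproj_eq; rewrite -scalerBr; apply: rpredZ.
by apply/qproj_eq; rewrite /qproj reprK.
Qed.

Fact qscaleA a b v : qscale a (qscale b v) = qscale (a * b) v.
Proof. by case: (qproj_surj v) => x <-; rewrite !qscaleE scalerA. Qed.
Fact qscale1 : left_id 1 qscale.
Proof. by move=> v; case: (qproj_surj v) => x <-; rewrite !qscaleE scale1r. Qed.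
Fact qscaleDr : right_distributive qscale +%R.
Proof.
move=> r u v; case: (qproj_surj v) => x <-; case: (qproj_surj u) => y <-.
by rewrite -raddfD !qscaleE scalerDr raddfD.
Qed.
Fact qscaleDl v : {morph qscale^~ v : a b / a + b}.
Proof.
by move=> a b; case: (qproj_surj v) => x <-; rewrite !qscaleE scalerDl raddfD.
Qed.

HB.instance Definition _ := GRing.Zmodule_isLmodule.Build R quotmod
  qscaleA qscale1 qscaleDr qscaleDl.

Fact qproj_scalable : scalable qproj.
Proof. by move=> r x; rewrite -qscaleE. Qed.

HB.instance Definition _ := GRing.isScalable.Build _ _ _ _ qproj qproj_scalable.

End QuotientModule.

Section KernelSequences.
Variables (R : comPzRingType) (U V : lmodType R) (f : {linear U -> V}).

Definition ker_mod : lmodType R := submod (kerb f).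
Definition im_mod : lmodType R := submod (imb f).
Definition coker_mod : lmodType R := quotmod (imb f).

Definition ker_incl : {linear ker_mod -> U} := \val.
Definition im_incl : {linear im_mod -> V} := \val.
Definition coker_proj : {linear V -> coker_mod} := @qproj R V (imb f).

Lemma ker_inclP (x : U) : f x = 0 -> exists k, ker_incl k = x.
Proof. by move=> /eqP h; exists (exist _ x h). Qed.

Lemma ker_incl0 k : f (ker_incl k) = 0.
Proof. by case: k => x /= /eqP. Qed.

Lemma ker_ses : surj f -> ses ker_incl f.
Proof.
move=> hf; split=> // y; by split=> [/ker_inclP //|[k <-]]; apply: ker_incl0.
Qed.

Lemma coker_ses : injective f -> ses f coker_proj.
Proof.
move=> hf; split=> //; last exact: qproj_surj.
move=> y; rewrite -[0](linear0 coker_proj) qproj_eq subr0.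
by split => [/asboolP //|h]; apply/asboolP.
Qed.

Fact im_mem x : f x \in imb f.
Proof. by apply/asboolP; exists x. Qed.

Definition im_corestr (x : U) : im_mod := exist _ (f x) (im_mem x).

Fact im_corestr_linear : linear im_corestr.
Proof. by move=> a x y; apply: val_inj; rewrite /= linearP. Qed.

HB.instance Definition _ :=
  GRing.isLinear.Build R U im_mod *:%R im_corestr im_corestr_linear.

Lemma im_corestr_surj : surj im_corestr.
Proof. by case=> y hy; have /asboolP[x e] := hy; exists x; apply: val_inj. Qed.

End KernelSequences.

(** * Right exactness of the tensor product *)

Section TensorExact.
Variable R : comPzRingType.
Implicit Types M N A B C : lmodType R.

Lemma tensor_mapB M A B (f : {linear A -> B}) s t :
  tensor_map M f (s - t) = tensor_map M f s - tensor_map M f t.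
Proof. exact: tensor_map_zmod_morphism. Qed.

Lemma tensor_map_comp M A B C (f : {linear A -> B}) (g : {linear B -> C})
  (h : {linear A -> C}) : (forall x, g (f x) = h x) ->
  forall t, tensor_map M g (tensor_map M f t) = tensor_map M h t.
Proof.
move=> e; apply: tensor_ext => [s t|s t|m n]; rewrite ?tensor_mapB //.
by rewrite !tensor_mapE e.
Qed.

Lemma tens0r M N (m : M) : tens m (0 : N) = 0.
Proof. by apply: (addrI (tens m 0)); rewrite -tensDr !addr0. Qed.

Lemma tens0l M N (n : N) : tens (0 : M) n = 0.
Proof. by apply: (addrI (tens 0 n)); rewrite -tensDl !addr0. Qed.

Lemma tensNr M N (m : M) (n : N) : tens m (- n) = - tens m n.
Proof. by apply: (addrI (tens m n)); rewrite -tensDr !subrr tens0r. Qed.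

Lemma tensBr M N (m : M) (n n' : N) : tens m (n - n') = tens m n - tens m n'.
Proof. by rewrite tensDr tensNr. Qed.

Lemma tens_suml M N (n : N) I (r : seq I) (F : I -> M) :
  tens (\sum_(i <- r) F i) n = \sum_(i <- r) tens (F i) n.
Proof.
by elim: r => [|i r IH]; rewrite ?big_nil ?tens0l // !big_cons tensDl IH.
Qed.

Lemma tensor_map0 M A B C (f : {linear A -> B}) (g : {linear B -> C}) :
  (forall x, g (f x) = 0) ->
  forall t, tensor_map M g (tensor_map M f t) = 0.
Proof.
move=> e; elim/tensor_ind => [m n|s t hs ht]; last by rewrite !tensor_mapB hs ht subr0.
by rewrite !tensor_mapE e tens0r.
Qed.

Lemma tensor_map_surj M B C (g : {linear B -> C}) :
  surj g -> surj (tensor_map M g).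
Proof.
move=> hg; elim/tensor_ind => [m c|s t [x <-] [y <-]].
  by case: (hg c) => b <-; exists (tens m b); rewrite tensor_mapE.
by exists (x - y); rewrite tensor_mapB.
Qed.

(** Modulo the image of [tensor_map M f], the class of [tens m b] depends only on [g b]. Hence a
    mere set-theoretic section [s] of [g] induces a map from [tensor M C] to the cokernel [Q], whose
    composite with [tensor_map M g] is the projection [q]; an element killed by [tensor_map M g]
    thus has class zero. *)
Lemma tensor_map_exact M A B C (f : {linear A -> B}) (g : {linear B -> C}) :
  exact_at f g -> surj g -> exact_at (tensor_map M f) (tensor_map M g).
Proof.
move=> hfg hg t; split; last first.
  case=> x <-; apply: tensor_map0 => a.
  by apply/hfg; exists a.
set Q := coker_mod (tensor_map M f).
pose q : {linear tensor M B -> Q} := coker_proj (tensor_map M f).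
have [s hs] : {s : C -> B | forall c, g (s c) = c}.
  by exists (fun c => projT1 (cid (hg c))) => c; case: cid.
have qE m b b' : g b = g b' -> q (tens m b) = q (tens m b').
  move=> e; apply/qproj_eq; rewrite -tensBr; apply/asboolP.
  have /hfg[a <-] : g (b - b') = 0 by rewrite linearB e subrr.
  by exists (tens m a); apply: tensor_mapE.
have bb : balanced (fun m c => q (tens m (s c))).
  split=> [m1 m2 n|m n1 n2|r m n].
  - by rewrite tensDl linearD.
  - by rewrite -linearD -tensDr; apply: qE; rewrite linearD !hs.
  - by rewrite tensZ; apply: qE; rewrite linearZ /= !hs.
have key u : tensor_lift (fun m c => q (tens m (s c))) (tensor_map M g u) = q u.
  elim/tensor_ind: u => [m b|u v hu hv].
    by rewrite tensor_mapE tensor_liftE //; apply: qE; rewrite hs.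
  by rewrite !tensor_mapB tensor_liftB // hu hv raddfB.
move=> e; have := key t; rewrite e -[X in tensor_lift _ X](subrr 0) tensor_liftB //.
rewrite subrr => /esym; rewrite -[0](linear0 q) => /qproj_eq.
by rewrite subr0 => /asboolP.
Qed.

End TensorExact.

Arguments tensor_map_surj {R} M {B C g} _ _.
Arguments tensor_map_exact {R} M {A B C f g} _ _ _.

(** * Functoriality in the left factor, and symmetry *)

Section TensorLeft.
Variables (R : comPzRingType) (M M' N : lmodType R) (f : {linear M -> M'}).

Definition tensor_mapl : tensor M N -> tensor M' N :=
  tensor_lift (fun m n => tens (f m) n).

Let mapl_balanced : balanced (fun (m : M) (n : N) => tens (f m) n).
Proof. by split=> *; rewrite ?linearD ?tensDl ?tensDr // linearZ tensZ. Qed.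

Lemma tensor_maplE m n : tensor_mapl (tens m n) = tens (f m) n.
Proof. exact: tensor_liftE. Qed.

Fact tensor_mapl_zmod_morphism : zmod_morphism tensor_mapl.
Proof. exact: tensor_liftB. Qed.

HB.instance Definition _ := GRing.isZmodMorphism.Build _ _ tensor_mapl
  tensor_mapl_zmod_morphism.

End TensorLeft.

Arguments tensor_mapl {R M M'} N f.

Section TensorSwap.
Variables (R : comPzRingType) (M N : lmodType R).

Definition tensor_swap : tensor M N -> tensor N M :=
  tensor_lift (fun m n => tens n m).

Let swap_balanced : balanced (fun (m : M) (n : N) => tens n m).
Proof. by split=> *; rewrite ?tensDl ?tensDr // tensZ. Qed.

Lemma tensor_swapE m n : tensor_swap (tens m n) = tens n m.
Proof. exact: tensor_liftE. Qed.

Fact tensor_swap_zmod_morphism : zmod_morphism tensor_swap.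
Proof. exact: tensor_liftB. Qed.

HB.instance Definition _ := GRing.isZmodMorphism.Build _ _ tensor_swap
  tensor_swap_zmod_morphism.

End TensorSwap.

Section Bifunctor.
Variable R : comPzRingType.
Implicit Types A B C K L M N P Q : lmodType R.

Lemma tensor_maplB M M' N (f : {linear M -> M'}) s t :
  tensor_mapl N f (s - t) = tensor_mapl N f s - tensor_mapl N f t.
Proof. exact: tensor_mapl_zmod_morphism. Qed.

Lemma tensor_swapB M N (s t : tensor M N) :
  tensor_swap (s - t) = tensor_swap s - tensor_swap t.
Proof. exact: tensor_swap_zmod_morphism. Qed.

Lemma tensor_swapK M N : cancel (@tensor_swap R M N) (@tensor_swap R N M).
Proof.
apply: tensor_ext => [s t|s t|m n]; rewrite ?(tensor_mapB, tensor_maplB, tensor_swapB) //.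
by rewrite !tensor_swapE.
Qed.

Lemma tensor_mapl_swap M M' N (f : {linear M -> M'}) t :
  tensor_mapl N f (tensor_swap t) = tensor_swap (tensor_map N f t).
Proof.
move: t; apply: tensor_ext => [s t|s t|m n];
  rewrite ?(tensor_mapB, tensor_maplB, tensor_swapB) //.
by rewrite tensor_mapE !tensor_swapE tensor_maplE.
Qed.

Lemma tensor_map_swap M M' N (f : {linear M -> M'}) t :
  tensor_map N f (tensor_swap t) = tensor_swap (tensor_mapl N f t).
Proof. by rewrite -[t in RHS]tensor_swapK tensor_mapl_swap tensor_swapK. Qed.

Lemma tensor_mapC K P L Q (k : {linear K -> P}) (l : {linear L -> Q}) t :
  tensor_mapl Q k (tensor_map K l t) = tensor_map P l (tensor_mapl L k t).
Proof.
move: t; apply: tensor_ext => [s t|s t|m n];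
  rewrite ?(tensor_mapB, tensor_maplB, tensor_swapB) //.
by rewrite tensor_mapE !tensor_maplE tensor_mapE.
Qed.

Lemma tensor_mapl_inj M M' N (f : {linear M -> M'}) :
  injective (tensor_mapl N f) <-> injective (tensor_map N f).
Proof.
split=> h x y e; apply: (can_inj (@tensor_swapK _ _)); apply: h.
  by rewrite !tensor_mapl_swap e.
by rewrite !tensor_map_swap e.
Qed.

Lemma tensor_mapl_surj N A B (g : {linear A -> B}) :
  surj g -> surj (tensor_mapl N g).
Proof.
move=> hg t; have [x e] := tensor_map_surj N hg (tensor_swap t).
by exists (tensor_swap x); rewrite tensor_mapl_swap e tensor_swapK.
Qed.

Lemma tensor_mapl_exact N A B C (f : {linear A -> B}) (g : {linear B -> C}) :
  exact_at f g -> surj g -> exact_at (tensor_mapl N f) (tensor_mapl N g).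
Proof.
move=> hfg hg t; have := tensor_map_exact N hfg hg (tensor_swap t).
rewrite tensor_map_swap => h; split.
  move=> e; have [|x ex] := proj1 h; first by rewrite e raddf0.
  by exists (tensor_swap x); rewrite tensor_mapl_swap ex tensor_swapK.
case=> x e; apply: (can_inj (@tensor_swapK _ _)); rewrite raddf0; apply/h.
by exists (tensor_swap x); rewrite tensor_map_swap e.
Qed.

Arguments tensor_mapl_surj N {A B g} _ _.
Arguments tensor_mapl_exact N {A B C f g} _ _ _.

(** The fragment of the snake lemma on which every comparison of presentations below rests. An
    element of the kernel of M (x) l is lifted to P (x) L, pushed to P (x) Q, and traced back
    through K (x) Q to K (x) L. *)
Lemma tensor_snake K P M L Q N
    (k : {linear K -> P}) (p : {linear P -> M})
    (l : {linear L -> Q}) (q : {linear Q -> N}) :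
  exact_at k p -> surj p -> exact_at l q -> surj q ->
  injective (tensor_map P l) -> injective (tensor_mapl N k) ->
  injective (tensor_map M l).
Proof.
move=> ekp hp elq hq iPl ikN; apply: raddf_inj0 => t et.
have [s es] := tensor_mapl_surj L hp t.
have /(tensor_mapl_exact Q ekp hp)[u eu] : tensor_mapl Q p (tensor_map P l s) = 0.
  by rewrite tensor_mapC es.
have /(tensor_map_exact K elq hq)[v ev] : tensor_map K q u = 0.
  apply: ikN; rewrite raddf0 tensor_mapC eu tensor_map0 // => x.
  by apply/elq; exists x.
have e : s = tensor_mapl L k v by apply: iPl; rewrite -tensor_mapC ev eu.
by rewrite -es e; apply/(tensor_mapl_exact L ekp hp); exists v.
Qed.

End Bifunctor.

Arguments tensor_mapl_surj {R} N {A B g} _ _.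
Arguments tensor_mapl_exact {R} N {A B C f g} _ _ _.

(** * Vanishing of Tor *)

Section Flat.
Variable R : comPzRingType.
Implicit Types A B C K L M N P Q : lmodType R.

(** All extensions of [N] are quantified over, so no resolution has to be chosen; [tor1_zeroP] and
    [tor1_zeroPr] show that a single flat presentation of either argument decides the matter. *)
Definition tor1_zero M N : Prop :=
  forall L Q (l : {linear L -> Q}) (q : {linear Q -> N}),
    ses l q -> injective (tensor_map M l).

Lemma flat_mapl P A B (f : {linear A -> B}) :
  flat P -> injective f -> injective (tensor_mapl P f).
Proof. by move=> hP hf; apply/tensor_mapl_inj/hP. Qed.

Lemma tor1_zero_flatl P N : flat P -> tor1_zero P N.
Proof. by move=> hP L Q l q [hl _ _]; apply: hP. Qed.

Lemma flat_tor1 M : (forall N, tor1_zero M N) -> flat M.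
Proof.
move=> h A B f hf; exact: (h (coker_mod f) _ _ _ _ (coker_ses hf)).
Qed.

End Flat.

(** * Free covers, syzygies and dimension shifting *)

Section FreeModule.
Variable R : comNzRingType.
Implicit Types A B C K L M N P Q : lmodType R.

Section Lift.
Variables (T : choiceType) (M : lmodType R) (f : T -> M).

Fact fglift_zmod_morphism : zmod_morphism (fglift f : {freeg T / R} -> M).
Proof. exact: lift_is_additive. Qed.

HB.instance Definition _ := GRing.isZmodMorphism.Build {freeg T / R} M
  (fglift f) fglift_zmod_morphism.

Lemma fgliftE (D : {freeg T / R}) :
  fglift f D = \sum_(x <- dom D) coeff x D *: f x.
Proof.
rewrite -[D in LHS]freeg_sumE raddf_sum; apply: eq_bigr => x _ /=.
by rewrite liftU.
Qed.

Fact fglift_scalable : scalable (fglift f).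
Proof.
move=> c D; rewrite [c *: D]/(GRing.scale _ _) /= /fgscale raddf_sum fgliftE.
by rewrite scaler_sumr; apply: eq_bigr => x _; rewrite /= liftU scalerA.
Qed.

HB.instance Definition _ := GRing.isScalable.Build R {freeg T / R} M *:%R
  (fglift f) fglift_scalable.

End Lift.

Definition Free M : lmodType R := {freeg M / R}.
Definition cover M : {linear Free M -> M} := fglift (id : M -> M).
Definition Omega M : lmodType R := ker_mod (cover M).

Lemma coverE M (x : M) : cover M << x >> = x.
Proof. by rewrite /cover /= liftU scale1r. Qed.

Lemma cover_surj M : surj (cover M).
Proof. by move=> x; exists << x >>; apply: coverE. Qed.

Lemma cover_ses M : ses (ker_incl (cover M)) (cover M).
Proof. exact/ker_ses/cover_surj. Qed.

Lemma Free_lift M B C (g : {linear B -> C}) (f : {linear Free M -> C}) :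
  surj g -> exists h : {linear Free M -> B}, forall x, g (h x) = f x.
Proof.
move=> hg; have /choice[s hs] : forall m : M, exists b, g b = f << m >>.
  by move=> m; apply: hg.
exists (fglift s : {linear Free M -> B}) => x.
rewrite /= fgliftE linear_sum -[x in RHS]freeg_sumE linear_sum.
apply: eq_bigr => z _; rewrite linearZ hs /= -linearZ; congr (f _).
apply/eqP/freeg_eqP => y; rewrite coeffZ !coeffU.
by rewrite mul1r.
Qed.

Section FreeFlat.
Variables (T : choiceType) (A : lmodType R).

(** The coordinate at [m] under the isomorphism of R^(T) (x) A with A^(T). *)
Definition tensor_coef (m : T) : tensor {freeg T / R} A -> A :=
  tensor_lift (fun x a => coeff m x *: a).

Let coef_balanced m : balanced (fun (x : {freeg T / R}) (a : A) => coeff m x *: a).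
Proof.
split=> [x y a|x a b|r x a]; rewrite ?coeffD ?scalerDl ?scalerDr //.
by rewrite coeffZ scalerA mulrC.
Qed.

Lemma tensor_coefE m x a : tensor_coef m (tens x a) = coeff m x *: a.
Proof. exact: tensor_liftE. Qed.

Lemma tensor_coefB m s t : tensor_coef m (s - t) = tensor_coef m s - tensor_coef m t.
Proof. exact: tensor_liftB. Qed.

(** The list [s] bounds the support of [t]. Allowing every larger duplicate-free list lets the
    bounds of two elements be merged when their difference is treated. *)
Lemma tensor_coef_sum t : exists s : seq T, forall s', uniq s' -> {subset s <= s'} ->
  t = \sum_(m <- s') tens (<< m >> : {freeg T / R}) (tensor_coef m t).
Proof.
elim/tensor_ind: t => [x a|t u [s hs] [s1 hs1]].
  exists (dom x) => s' us' ss'.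
  under eq_bigr => m _ do rewrite tensor_coefE -tensZ.
  rewrite -tens_suml; congr tens; apply/eqP/freeg_eqP => y.
  rewrite raddf_sum /=; have [yx|yx] := boolP (y \in s').
    rewrite (bigD1_seq y) //= coeffZ coeffU eqxx mulr1 mulr1 big1 ?addr0 // => i /negPf hi.
    by rewrite coeffZ coeffU hi !mulr0.
  rewrite coeff_outdom; last by apply: contra yx; apply: ss'.
  rewrite big1_seq // => i /andP[_ hi]; rewrite coeffZ coeffU.
  by case: eqP hi yx => [-> ->//|_ _ _]; rewrite !mulr0.
exists (s ++ s1) => s' us' ss'.
rewrite [in LHS](hs s') //; last by move=> z hz; apply: ss'; rewrite mem_cat hz.
rewrite [u in LHS](hs1 s') //; last by move=> z hz; apply: ss'; rewrite mem_cat hz orbT.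
rewrite -sumrB; apply: eq_bigr => m _.
by rewrite tensor_coefB tensBr.
Qed.

Lemma tensor_coef_eq0 t : (forall m, tensor_coef m t = 0) -> t = 0.
Proof.
move=> h; have [s hs] := tensor_coef_sum t.
rewrite (hs (undup s)) ?undup_uniq //; last by move=> x; rewrite mem_undup.
by rewrite big1 // => m _; rewrite h tens0r.
Qed.

End FreeFlat.

Lemma tensor_coef_map (T : choiceType) A B (f : {linear A -> B}) (m : T) t :
  tensor_coef m (tensor_map {freeg T / R} f t) = f (tensor_coef m t).
Proof.
elim/tensor_ind: t => [x a|s t hs ht].
  by rewrite tensor_mapE !tensor_coefE linearZ.
by rewrite tensor_mapB !tensor_coefB hs ht linearB.
Qed.

(** Tensoring with a free module applies [f] to each coordinate, and coordinates detect zero. *)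
Lemma Free_flat M : flat (Free M).
Proof.
move=> A B f hf; apply: raddf_inj0 => t ht; apply: tensor_coef_eq0 => m.
apply: hf; rewrite linear0 -tensor_coef_map.
by rewrite -[LHS]/(tensor_coef m (tensor_map (Free M) f t)) ht -(subrr 0) tensor_coefB subrr.
Qed.

Arguments Free_flat M [A B f] _ [x1 x2] _.

(** Passes from injectivity in the right variable to injectivity in the left one: the snake argument
    is run against the free cover of [N]. *)
Lemma tor1_zero_ses K P M N (k : {linear K -> P}) (p : {linear P -> M}) :
  ses k p -> tor1_zero M N -> injective (tensor_mapl N k).
Proof.
move=> [hk ekp hp] h; apply/tensor_mapl_inj.
have [_ ec hc] := cover_ses N.
apply: (tensor_snake ec hc ekp hp).
  by apply/tensor_mapl_inj/flat_mapl => //; apply: Free_flat.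
exact/tensor_mapl_inj/(h _ _ _ _ (cover_ses N)).
Qed.

Lemma tor1_zeroP K P M N (k : {linear K -> P}) (p : {linear P -> M}) :
  ses k p -> flat P -> tor1_zero M N <-> injective (tensor_mapl N k).
Proof.
move=> hs hP; split=> [h|h L Q l q [hl elq hq]]; first exact: tor1_zero_ses hs h.
have [_ ekp hp] := hs.
apply: (tensor_snake ekp hp elq hq) => //; exact: hP.
Qed.

Lemma tor1_zeroPr L Q M N (l : {linear L -> Q}) (q : {linear Q -> N}) :
  ses l q -> flat Q -> tor1_zero M N <-> injective (tensor_map M l).
Proof.
move=> hs hQ; split=> [h|h]; first exact: h hs.
have [hl elq hq] := hs.
apply/(tor1_zeroP _ (cover_ses M) (Free_flat M)).
have [hk ekp hp] := cover_ses M.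
apply/tensor_mapl_inj/(tensor_snake elq hq ekp hp).
  by apply/tensor_mapl_inj/flat_mapl.
exact/tensor_mapl_inj.
Qed.

Lemma tor1_zero_flatr M Q : flat Q -> tor1_zero M Q.
Proof.
move=> hQ; apply/(tor1_zeroP _ (cover_ses M) (Free_flat M)).
by apply: flat_mapl => //; case: (cover_ses M).
Qed.

Section LongExactSequence.
Variables (A B C : lmodType R) (f : {linear A -> B}) (g : {linear B -> C}).
Hypothesis hfg : ses f g.

(** Exactness of Tor_1(M, A) -> Tor_1(M, B) -> Tor_1(M, C). *)
Lemma tor1_zero_ext M : tor1_zero M A -> tor1_zero M C -> tor1_zero M B.
Proof.
move=> /(tor1_zeroP _ (cover_ses M) (Free_flat M)) hA hC.
have /(tor1_zeroP _ (cover_ses M) (Free_flat M)) hC' := hC.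
apply/(tor1_zeroP _ (cover_ses M) (Free_flat M)).
have [hf efg hg] := hfg.
apply: raddf_inj0 => t et.
have /(tensor_map_exact _ efg hg)[s es] :
  tensor_map (Omega M) g t = 0.
  by apply: hC'; rewrite tensor_mapC et !raddf0.
suff : s = 0 by move=> e; rewrite -es e raddf0.
apply: hA; rewrite raddf0; apply: (Free_flat _ hf).
by rewrite -tensor_mapC es et raddf0.
Qed.

Variables (K P M : lmodType R) (k : {linear K -> P}) (p : {linear P -> M}).
Hypotheses (hkp : ses k p) (hP : flat P).

(** As [K] is a first syzygy of [M], this is exactness of Tor_2(M, C) -> Tor_1(M, A) -> Tor_1(M,
    B). *)
Lemma tor1_zero_sub : tor1_zero M B -> tor1_zero K C -> tor1_zero M A.
Proof.
move=> /(tor1_zeroP _ hkp hP) hB /(_ _ _ _ _ hfg) hKC.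
apply/(tor1_zeroP _ hkp hP) => s t e; apply: hKC; apply: hB.
by rewrite !tensor_mapC e.
Qed.

(** Exactness of Tor_2(M, B) -> Tor_2(M, C) -> Tor_1(M, A), with Tor_2(M, -) read as Tor_1(K, -). *)
Lemma tor1_zero_quot : tor1_zero M A -> tor1_zero K B -> tor1_zero K C.
Proof.
move=> /(tor1_zeroP _ hkp hP) hA /(tor1_zeroP _ (cover_ses K) (Free_flat K)) hB.
have [hf efg hg] := hfg.
have iKf : injective (tensor_map K f).
  move=> s t e; apply: hA; apply: (hP hf).
  by rewrite -!tensor_mapC e.
apply/(tor1_zeroP _ (cover_ses K) (Free_flat K)).
have [_ ec hc] := cover_ses K.
apply: raddf_inj0 => t et.
have [s es] := tensor_map_surj _ hg t.
have : tensor_map (Free K) g (tensor_mapl B (ker_incl (cover K)) s) = 0.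
  by rewrite -tensor_mapC es et.
move=> /(tensor_map_exact _ efg hg)[u eu].
have /(tensor_mapl_exact _ ec hc)[v ev] : tensor_mapl A (cover K) u = 0.
  apply: iKf; rewrite -tensor_mapC eu raddf0.
  by apply/(tensor_mapl_exact _ ec hc); exists s.
have e : s = tensor_map (Omega K) f v.
  by apply: hB; rewrite tensor_mapC ev eu.
by rewrite -es e; apply/(tensor_map_exact _ efg hg); exists v.
Qed.

End LongExactSequence.

(** Both sides express Tor_2(M, N) = 0. The map K (x) L -> P (x) Q factors through K (x) Q and
    through P (x) L, with injective second factors by flatness, so each side amounts to its
    injectivity. *)
Lemma tor1_zero_balance K P M L Q N (k : {linear K -> P}) (p : {linear P -> M})
    (l : {linear L -> Q}) (q : {linear Q -> N}) :
  ses k p -> flat P -> ses l q -> flat Q -> tor1_zero K N <-> tor1_zero M L.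
Proof.
move=> hkp hP hlq hQ; have [hk _ _] := hkp; have [hl _ _] := hlq.
rewrite (tor1_zeroPr _ hlq hQ) (tor1_zeroP _ hkp hP); split=> h s t e.
  by apply: h; apply: (flat_mapl hQ hk); rewrite !tensor_mapC e.
by apply: h; apply: (hP _ _ _ hl); rewrite -!tensor_mapC e.
Qed.

Lemma flat_ext A B C (f : {linear A -> B}) (g : {linear B -> C}) :
  ses f g -> flat A -> flat C -> flat B.
Proof.
move=> h hA hC; have swap M N : tor1_zero M N <-> tor1_zero N M.
  rewrite (tor1_zeroP _ (cover_ses M) (Free_flat M)).
  by rewrite (tor1_zeroPr _ (cover_ses M) (Free_flat M)) tensor_mapl_inj.
by apply: flat_tor1 => N; apply/swap/(tor1_zero_ext h); apply/swap/tor1_zero_flatl.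
Qed.

Lemma iter_Omega_tor1 n M N :
  tor1_zero (iter n Omega M) N <-> tor1_zero M (iter n Omega N).
Proof.
elim: n M N => [|n IH] M N //; rewrite iterS.
rewrite (tor1_zero_balance (cover_ses _) (Free_flat _) (cover_ses N) (Free_flat _)).
by rewrite -/(Omega N) IH -iterSr.
Qed.

(** Both sides say that Tor_{n+2}(M, -) vanishes. This frees the flat dimension from the chosen free
    covers: any flat presentation may serve as the first step. *)
Lemma iter_Omega_flat n K P M (k : {linear K -> P}) (p : {linear P -> M}) :
  ses k p -> flat P -> flat (iter n.+1 Omega M) <-> flat (iter n Omega K).
Proof.
move=> hkp hP; split=> h; apply: flat_tor1 => N.
  apply/iter_Omega_tor1/(tor1_zero_balance hkp hP (cover_ses _) (Free_flat _)).
  exact/(iter_Omega_tor1 n.+1)/tor1_zero_flatl.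
apply/(iter_Omega_tor1 n.+1)/(tor1_zero_balance hkp hP (cover_ses _) (Free_flat _)).
exact/iter_Omega_tor1/tor1_zero_flatl.
Qed.

Lemma flat_Omega P : flat P -> flat (Omega P).
Proof.
move=> hP; apply: flat_tor1 => N.
by apply/(iter_Omega_tor1 1)/tor1_zero_flatl.
Qed.

End FreeModule.

Arguments Free {R} M.
Arguments Omega {R} M.

Arguments Free_flat {R} M [A B f] _ [x1 x2] _.

(** * Injective modules *)

Section Divisible.
Local Open Scope classical_set_scope.
Variable D : zmodType.
Hypothesis divD : forall n (d : D), (0 < n)%N -> exists e, e *+ n = d.

Section Extension.
Variables (A B : zmodType) (i : {additive A -> B}) (f : {additive A -> D}).
Hypothesis inj_i : injective i.

Let graph (S : set (B * D)) : Prop :=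
  [/\ forall b d b' d', S (b, d) -> S (b', d') -> S (b - b', d - d'),
      forall d, S (0, d) -> d = 0 &
      forall u, S u -> forall a, S (i a, f a)].

Let graph_mulz S b d (k : int) : graph S -> S (b, d) -> S (b *~ k, d *~ k).
Proof.
move=> [SB _ _] Sbd.
have S0 : S (0, 0) by rewrite -(subrr b) -(subrr d); apply: SB.
have SN x y : S (x, y) -> S (- x, - y) by rewrite -(sub0r x) -(sub0r y); apply: SB.
have SD x y z w : S (x, y) -> S (z, w) -> S (x + z, y + w).
  by move=> h h'; rewrite -[z]opprK -[w]opprK; apply/SB/SN.
have Sn n : S (b *+ n, d *+ n).
  elim: n => [|n IH]; first by rewrite !mulr0n.
  by rewrite !mulrSr; apply: SD.
case: k => n; first exact: Sn.
by rewrite !NegzE !mulrNz; apply/SN/Sn.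
Qed.

Let graph_adjoin S b : graph S -> S (0, 0) -> (exists d, S (b, d)) \/
  exists S', [/\ graph S', S `<=` S' & exists d, S' (b, d)].
Proof.
move=> gS S0; have [SB Sf Si] := gS.
(* A value [e] at [b] is admissible once it agrees with [S] on every multiple of [b] in the domain;
   [S] + Z(b, e) is then single-valued. *)
suff [e he] : exists e, forall k d, S (b *~ k, d) -> d = e *~ k.
  right; pose S' := [set u | exists x y (k : int), S (x, y) /\ u = (x + b *~ k, y + e *~ k)].
  have sub : S `<=` S'.
    by move=> [x y] Su; exists x, y, 0; rewrite !mulr0z !addr0.
  exists S'; split=> //; last by exists e, 0, 0, 1; rewrite !add0r !mulr1z.
  split.
  - move=> _ _ _ _ [x [y [k [Sv [-> ->]]]]] [x' [y' [k' [Sv' [-> ->]]]]].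
    exists (x - x'), (y - y'), (k - k'); split; first exact: SB.
    by rewrite !mulrzBr; congr pair; rewrite opprD addrACA.
  - move=> d [x [y [k [Sv [ex ->]]]]].
    have /he -> : S (b *~ - k, y).
      by rewrite mulrNz; move/eqP: ex; rewrite eq_sym addr_eq0 => /eqP <-.
    by rewrite mulrNz addNr.
  - by move=> _ _ a; apply/sub/(Si _ S0).
(* Let (n+1)b be the least positive multiple of [b] in the domain and [d0] its value; [e] is chosen
   with (n+1)e = [d0]. If there is no such multiple, every [e] is admissible, and 0 is taken. *)
pose I n := `[< exists d, S (b *+ n.+1, d) >].
have [[n In]|noI] := pselect (exists n, I n); last first.
  exists 0 => k d Skd; rewrite mul0rz.
  suff k0 : k = 0 by move: Skd; rewrite k0 mulr0z => /Sf.
  case: k Skd => [[|n]|n] // Sn; case: noI; exists n; apply/asboolP.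
    by exists d.
  exists (- d); have := graph_mulz (-1) gS Sn.
  by rewrite NegzE !mulrNz opprK !mulr1z.
have exI : exists n, I n by exists n.
case: (ex_minnP exI) => {n In}n /asboolP[d0 Sd0] minn.
have [e ed0] := divD d0 (ltn0Sn n).
exists e => k d Skd.
have hm : (k %% n.+1)%Z = `|(k %% n.+1)%Z|%N by rewrite gez0_abs // modz_ge0.
have Sr : S (b *~ (k %% n.+1)%Z, d - d0 *~ (k %/ n.+1)%Z).
  have -> : (k %% n.+1)%Z = k - (k %/ n.+1)%Z * n.+1.
    by rewrite {2}(divz_eq k n.+1) addrC addKr.
  rewrite mulrzBr mulrC mulrzA.
  exact: SB Skd (graph_mulz _ gS Sd0).
case E : `|(k %% n.+1)%Z|%N hm => [|r] hr.
  rewrite hr mulr0z in Sr; move/Sf/eqP: Sr; rewrite subr_eq0 => /eqP ->.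
  by rewrite -ed0 pmulrn -mulrzA {2}(divz_eq k n.+1) hr addr0 mulrC.
(* A nonzero remainder modulo n+1 would give a smaller positive multiple in the domain. *)
have /minn : I r by apply/asboolP; exists (d - d0 *~ (k %/ n.+1)%Z); rewrite hr in Sr.
rewrite leqNgt => /negP[].
by have := @ltz_pmod k n.+1 isT; rewrite hr ltz_nat.
Qed.

Lemma divisible_extension : exists g : {additive B -> D}, forall a, g (i a) = f a.
Proof.
pose G := [set u | exists a, u = (i a, f a)].
have gG : graph G.
  split=> [_ _ _ _ [a [-> ->]] [b [-> ->]]|d [a [ea ->]]|_ _ a]; last by exists a.
    by exists (a - b); rewrite !raddfB.
  have -> : a = 0 by apply: inj_i; rewrite raddf0.
  by rewrite raddf0.
have [S [gS maxS]] : exists S, graph S /\ forall S', S `<` S' -> ~ graph S'.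
  apply: Zorn_bigcup => F Fg Ftot; split.
  - move=> b d b' d' [X FX Xu] [Y FY Yv].
    have [XY|YX] := Ftot X Y FX FY.
      by exists Y => //; case: (Fg _ FY) => h _ _; apply: h => //; apply: XY.
    by exists X => //; case: (Fg _ FX) => h _ _; apply: h => //; apply: YX.
  - by move=> d [X FX Xd]; case: (Fg _ FX) => _ h _; apply: h.
  - by move=> u [X FX Xu] a; exists X => //; case: (Fg _ FX) => _ _ h; apply: h Xu a.
have maxS' S' : graph S' -> S `<=` S' -> S' `<=` S.
  move=> gS' sub; apply: contrapT => nsub; by apply: (maxS S') => //; split.
(* An empty [S] would lie in the graph [G] of [f], and maximality would make it contain [G]. *)
have [u Su] : exists u, S u.
  apply: contrapT => h; have h0 : S `<=` G by move=> u Su; case: h; exists u.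
  case: h; exists (0, 0); apply: (maxS' G gG h0).
  by exists 0; rewrite !raddf0.
have [SB Sf Si] := gS.
have S0 : S (0, 0) by have := Si _ Su 0; rewrite !raddf0.
have tot b : exists d, S (b, d).
  case: (graph_adjoin b gS S0) => // -[S' [gS' sub [d Sd]]].
  by exists d; apply: maxS' Sd.
have /choice[g hg] := tot.
have fun_ b d d' : S (b, d) -> S (b, d') -> d = d'.
  move=> h h'; apply/eqP; rewrite -subr_eq0; apply/eqP/Sf.
  by rewrite -(subrr b); apply: SB.
have gB : zmod_morphism g.
  by move=> x y; apply: (fun_ (x - y)) => //; apply: SB.
pose gh := GRing.isZmodMorphism.Build B D g gB.
pose ga : {additive B -> D} := HB.pack g gh.
by exists ga => a; apply: (fun_ (i a)) => //; apply: Si Su a.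
Qed.

End Extension.
End Divisible.

(** * Embedding an abelian group into a divisible one *)

Section DivisibleHull.
Variable M : zmodType.

Let ev (z : {freeg M / int}) : zmodule M := fglift (id : M -> zmodule M) z.

Let evB x y : ev (x - y) = ev x - ev y.
Proof. exact: lift_is_additive. Qed.

Let evU m : ev << m >> = m.
Proof. by rewrite /ev liftU scale1r. Qed.

Let coefq (z : {freeg M / int}) : M -> rat := fun m => (coeff m z)%:~R.

(** [M] is Z^(M) modulo the kernel of [ev]. Dividing the rational vector space of all functions on
    [M] by the same integral relations gives a divisible group that still contains [M]; no
    finiteness of support is needed for this. *)
Definition hull_rel : {pred (M -> rat)} :=
  fun f => `[< exists2 z, ev z = 0 & f = coefq z >].

Fact hull_rel_zmod_closed : zmod_closed hull_rel.
Proof.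
split.
  apply/asboolP; exists 0; first by rewrite -(subrr 0) evB subrr.
  by apply/funext => m; rewrite /coefq coeff0.
move=> f g /asboolP[z ez ->] /asboolP[z' ez' ->]; apply/asboolP.
exists (z - z'); first by rewrite evB ez ez' subrr.
by apply/funext => m; rewrite /coefq coeffB rmorphB.
Qed.

HB.instance Definition _ := GRing.isZmodClosed.Build _ hull_rel hull_rel_zmod_closed.

Definition div_hull : zmodType := Quotient.quot hull_rel.

Lemma div_hull_divisible n (d : div_hull) : (0 < n)%N -> exists e, e *+ n = d.
Proof.
move=> n0; elim/quotP: d => f _.
exists (\pi_(Quotient.quot hull_rel) (fun m => f m / n%:R)).
rewrite -raddfMn /=; congr (\pi_(_) _); apply/funext => m.
rewrite natmulfctE -[LHS]mulr_natr divfK //.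
by rewrite pnatr_eq0 -lt0n.
Qed.

Definition to_div_hull (m : M) : div_hull :=
  \pi_(Quotient.quot hull_rel) (coefq << m >>).

Let coefqB x y : coefq (x - y) = coefq x - coefq y.
Proof. by apply/funext => m; rewrite /coefq coeffB rmorphB. Qed.

Let to_div_hull_eq x y :
  \pi_(Quotient.quot hull_rel) (coefq x) = \pi_(Quotient.quot hull_rel) (coefq y)
  <-> ev x = ev y.
Proof.
split=> [/eqP|e].
  rewrite -Quotient.idealrBE -coefqB => /asboolP[z ez e].
  suff e' : z = x - y by move/eqP: ez; rewrite e' evB subr_eq0 => /eqP.
  apply/eqP/freeg_eqP => m; have /(congr1 (fun f => f m)) := e.
  by rewrite /coefq => /eqP; rewrite eqr_int => /eqP.
apply/eqP; rewrite -Quotient.idealrBE -coefqB; apply/asboolP.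
by exists (x - y) => //; rewrite evB e subrr.
Qed.

Fact to_div_hull_zmod_morphism : zmod_morphism to_div_hull.
Proof.
move=> x y; rewrite /to_div_hull -raddfB -coefqB; apply/to_div_hull_eq.
by rewrite evB !evU.
Qed.

HB.instance Definition _ :=
  GRing.isZmodMorphism.Build _ _ to_div_hull to_div_hull_zmod_morphism.

Lemma to_div_hull_inj : injective to_div_hull.
Proof. by move=> x y /to_div_hull_eq; rewrite !evU. Qed.

End DivisibleHull.

(** * Coinduced modules and enough injectives *)

Section Coinduced.
Variables (R : comPzRingType) (D : zmodType).

Definition additive_pred : {pred (R -> D)} := fun f => `[< zmod_morphism f >].

Fact additive_pred_zmod_closed : zmod_closed additive_pred.
Proof.
split; first by apply/asboolP => x y /=; rewrite subrr.
move=> f g /asboolP hf /asboolP hg; apply/asboolP => x y /=.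
rewrite -[LHS]/(f (x - y) - g (x - y)) -[RHS]/(f x - g x - (f y - g y)).
by rewrite hf hg !opprD addrACA.
Qed.

HB.instance Definition _ :=
  GRing.isZmodClosed.Build _ additive_pred additive_pred_zmod_closed.

(** This is Hom_Z(R, D), on which r acts by (r u)(x) = u(x r). *)
Definition coind : Type := {f : R -> D | f \in additive_pred}.

HB.instance Definition _ := [isSub of coind for @sval _ _].
HB.instance Definition _ := [Choice of coind by <:].
HB.instance Definition _ := [SubChoice_isSubZmodule of coind by <:].

Lemma coindB (u : coind) x y : val u (x - y) = val u x - val u y.
Proof. by case: u => f /= /asboolP. Qed.

Lemma coindD (u : coind) x y : val u (x + y) = val u x + val u y.
Proof.
have u0 : val u 0 = 0 by have := coindB u 0 0; rewrite !subrr.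
have uN z : val u (- z) = - val u z by have := coindB u 0 z; rewrite u0 !sub0r.
by have := coindB u x (- y); rewrite uN !opprK.
Qed.

Lemma coind_ext (u v : coind) : (forall x, val u x = val v x) -> u = v.
Proof. by move=> e; apply/val_inj/funext. Qed.

Fact coind_scale_subproof (r : R) (u : coind) : (fun x => val u (x * r)) \in additive_pred.
Proof. by apply/asboolP => x y /=; rewrite mulrBl coindB. Qed.

Definition coind_scale (r : R) (u : coind) : coind :=
  exist _ (fun x => val u (x * r)) (coind_scale_subproof r u).

Fact coind_scaleA a b v : coind_scale a (coind_scale b v) = coind_scale (a * b) v.
Proof. by apply: coind_ext => x /=; rewrite mulrA. Qed.
Fact coind_scale1 : left_id 1 coind_scale.
Proof. by move=> v; apply: coind_ext => x /=; rewrite mulr1. Qed.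
Fact coind_scaleDr : right_distributive coind_scale +%R.
Proof. by move=> r u v; apply: coind_ext. Qed.
Fact coind_scaleDl v : {morph coind_scale^~ v : a b / a + b}.
Proof.
by move=> a b; apply: coind_ext => x; rewrite /= mulrDr; apply: coindD.
Qed.

HB.instance Definition _ := GRing.Zmodule_isLmodule.Build R coind
  coind_scaleA coind_scale1 coind_scaleDr coind_scaleDl.

(** Evaluation at 1 identifies linear maps into Hom_Z(R, D) with additive maps into D, and the
    latter extend because D is divisible. *)
Lemma coind_injective :
  (forall n (d : D), (0 < n)%N -> exists e, e *+ n = d) -> injective_module coind.
Proof.
move=> divD A B i f inj_i.
pose f1 a := val (f a) 1.
have f1B : zmod_morphism f1 by move=> x y; rewrite /f1 linearB.
pose f1h := GRing.isZmodMorphism.Build A D f1 f1B.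
pose f1a : {additive A -> D} := HB.pack f1 f1h.
have [g hg] := divisible_extension divD f1a (inj_i : injective (i : {additive A -> B})).
have gP b : (fun r : R => g (r *: b)) \in additive_pred.
  by apply/asboolP => x y /=; rewrite scalerBl raddfB.
pose h b : coind := exist _ (fun r : R => g (r *: b)) (gP b).
have hlin : linear h.
  by move=> r x y; apply: coind_ext => s /=; rewrite scalerDr raddfD scalerA.
pose hh := GRing.isLinear.Build R B coind *:%R h hlin.
pose hl : {linear B -> coind} := HB.pack h hh.
exists hl => a; apply: coind_ext => s /=.
by rewrite -linearZ hg /= /f1 linearZ /= mul1r.
Qed.

End Coinduced.

(** The embedding sends m to the function r |-> r m with values in the divisible hull; evaluation at
    1 recovers m. *)
Lemma enough_injectives (R : comPzRingType) (M : lmodType R) :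
  exists (I : lmodType R) (i : {linear M -> I}), injective_module I /\ injective i.
Proof.
pose D := div_hull M; pose I : lmodType R := coind R D.
have jP m : (fun r : R => to_div_hull (r *: m)) \in @additive_pred R D.
  by apply/asboolP => x y /=; rewrite scalerBl raddfB.
pose j m : I := exist _ (fun r : R => to_div_hull (r *: m)) (jP m).
have jlin : linear j.
  by move=> r x y; apply: coind_ext => s /=; rewrite scalerDr raddfD scalerA.
pose jh := GRing.isLinear.Build R M I *:%R j jlin.
pose jl : {linear M -> I} := HB.pack j jh.
exists I, jl; split; first exact/coind_injective/div_hull_divisible.
move=> x y /(congr1 (fun u : I => val u 1)) /= /to_div_hull_inj.
by rewrite !scale1r.
Qed.

(** * Gorenstein flat modules *)

Section GorensteinFlat.
Variable R : comNzRingType.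
Implicit Types A B C F G I K L M N P Q Z : lmodType R.

Definition zeromod : lmodType R := 'rV[R]_0.

Lemma zeromodP : is_zero_module zeromod.
Proof. by move=> x; apply: thinmx0. Qed.

Lemma zero_ses_l A B C (f : {linear A -> B}) (g : {linear B -> C}) :
  is_zero_module A -> injective g -> surj g -> ses f g.
Proof.
move=> hA hg sg; split=> // [x y _|y]; first by rewrite (hA x) (hA y).
split=> [e|[x <-]]; last by rewrite (hA x) !linear0.
by exists 0; apply: hg; rewrite e !linear0.
Qed.

Lemma zero_ses_r A B C (f : {linear A -> B}) (g : {linear B -> C}) :
  is_zero_module C -> injective f -> surj f -> ses f g.
Proof.
by move=> hC hf sf; split=> // y; exists 0; rewrite linear0 (hC y).
Qed.

Lemma zero_flat Z : is_zero_module Z -> flat Z.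
Proof.
move=> hZ A B f _ s t _; have z u : u = 0 :> tensor Z A.
  elim/tensor_ind: u => [x a|u v -> ->]; last exact: subrr.
  by rewrite (hZ x) tens0l.
by rewrite (z s) (z t).
Qed.

Lemma tor1_zero_iso M A B (f : {linear A -> B}) :
  injective f -> surj f -> tor1_zero M A -> tor1_zero M B.
Proof.
move=> hf sf hA; have s := zero_ses_r (\0 : {linear B -> zeromod}) zeromodP hf sf.
by apply: (tor1_zero_ext s hA); apply/tor1_zero_flatr/zero_flat/zeromodP.
Qed.

Lemma tor1_zero_iso_sym M A B (f : {linear A -> B}) :
  injective f -> surj f -> tor1_zero M B -> tor1_zero M A.
Proof.
move=> hf sf hB; have s := zero_ses_l (\0 : {linear zeromod -> A}) zeromodP hf sf.
by apply: (tor1_zero_ext s _ hB); apply/tor1_zero_flatr/zero_flat/zeromodP.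
Qed.

Lemma flat_iso A B (f : {linear A -> B}) :
  injective f -> surj f -> flat A -> flat B.
Proof.
move=> hf sf hA; have s := zero_ses_r (\0 : {linear B -> zeromod}) zeromodP hf sf.
by apply: (flat_ext s hA); apply/zero_flat/zeromodP.
Qed.

Lemma splice_exact (A : Type) (B C D : zmodType) (E : Type) (v' : E -> A)
    (u' : A -> B) (v : B -> C) (u : {additive C -> D}) :
  surj v' -> exact_at u' v -> injective u ->
  exact_at (fun x => u' (v' x)) (fun x => u (v x)).
Proof.
move=> sv e iu y; split=> [h|[x <-]].
  have /e[a <-] : v y = 0 by apply: iu; rewrite h raddf0.
  by case: (sv a) => x <-; exists x.
by have -> : v (u' (v' x)) = 0; [apply/e; exists (v' x) | rewrite raddf0].
Qed.

(** The sequences 0 -> Z(n+1) -> F(n) -> Z(n) -> 0 are spliced into a two-sided complex, in which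
    Z(0) is the image of F(0) -> F(-1). The Tor hypothesis keeps each of them exact after tensoring
    with an injective module. *)
Lemma syzygies_gorenstein_flat (Z : int -> lmodType R) :
  (forall n : int, exists F (u : {linear Z (n + 1) -> F}) (v : {linear F -> Z n}),
     flat F /\ ses u v) ->
  (forall I n, injective_module I -> tor1_zero I (Z n)) ->
  gorenstein_flat (Z 0).
Proof.
move=> hF hI.
pose T (n : int) := {F : lmodType R & prod {linear Z (n + 1) -> F} {linear F -> Z n}}.
pose P (n : int) (X : T n) := flat (tag X) /\ ses (tagged X).1 (tagged X).2.
have [X hX] : {X : forall n, T n | forall n, P n (X n)}.
  have ex (n : int) : exists X, @P n X.
    by have [F [u [v h]]] := hF n; exists (existT _ F (u, v)).
  by exists (fun n => projT1 (cid (ex n))) => n; case: cid.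
pose u (n : int) : {linear Z (n + 1) -> tag (X n)} := (tagged (X n)).1.
pose v (n : int) : {linear tag (X n) -> Z n} := (tagged (X n)).2.
exists (fun n : int => tag (X n)), (fun n : int => u n \o v (n + 1)); split.
- by move=> n; case: (hX n).
- move=> n; have [_ [iu _ _]] := hX n; have [_ [_ e _]] := hX (n + 1).
  have [_ [_ _ sv]] := hX (n + 1 + 1).
  exact: (splice_exact sv e (iu : injective (u n : {additive _ -> _}))).
- exists (u (-1)); have [_ [iu _ _]] := hX (-1); have [_ [_ _ sv]] := hX 0.
  split=> //; apply/seteqP; split=> [_ [x _ <-]|_ [x _ <-]] /=.
    by have [y <-] := sv x; exists y.
  by exists (v 0 x).
- move=> I injI n.
  have iu : injective (tensor_map I (u n)).
    by apply: (hI I n injI); case: (hX n) => _; apply.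
  have [_ [_ e sv1]] := hX (n + 1); have [_ [_ _ sv]] := hX (n + 1 + 1).
  have := splice_exact (tensor_map_surj I sv) (tensor_map_exact I e sv1)
     (iu : injective (tensor_map I (u n) : {additive _ -> _})).
  move=> h y; split => [ey|[x <-]].
    have /h[x <-] : tensor_map I (u n) (tensor_map I (v (n + 1)) y) = 0.
      by rewrite -ey; apply: tensor_map_comp.
    by exists x; symmetry; apply: tensor_map_comp.
  have -> : tensor_map I (u (n + 1) \o v (n + 1 + 1)) x =
     tensor_map I (u (n + 1)) (tensor_map I (v (n + 1 + 1)) x).
    by symmetry; apply: tensor_map_comp.
  rewrite -[LHS](tensor_map_comp (f := v (n + 1)) (g := u n)) //.
  by apply/h; exists x.
Qed.

(** The statement is Tor_{k+1}(I, G) = 0. It is proved for all images in the complex at once: k = 0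
    is the exactness of I (x) F, and each further degree is a shift along 0 -> im d(n+1) -> F(n+1)
    -> im d(n) -> 0. *)
Lemma gorenstein_flat_tor1 I G k :
  injective_module I -> gorenstein_flat G -> tor1_zero (iter k Omega I) G.
Proof.
move=> injI [F [d [flatF exd [i [inj_i ri]] exI]]].
have s (n : int) : ses (im_incl (d (n + 1))) (im_corestr (d n)).
  split; [exact: val_inj| |exact: im_corestr_surj].
  move=> y; have e : im_corestr (d n) y = 0 <-> d n y = 0.
    by split=> [/(congr1 val)|h] //; apply: val_inj.
  split=> [/e/exd[x <-]|[[z hz] /= ez]].
    by exists (im_corestr (d (n + 1)) x).
  by apply/e/exd; rewrite -ez; have /asboolP := hz.
suff main (n : int) : tor1_zero (iter k Omega I) (im_mod (d n)).
  (* [G] is isomorphic to the image of d(-1), so the case n = -1 suffices. *)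
  have gP x : i x \in imb (d (-1)).
    have : range i (i x) by exists x.
    by rewrite ri => -[y _ e]; apply/asboolP; exists y.
  pose g x : im_mod (d (-1)) := exist _ (i x) (gP x).
  have glin : linear g by move=> a x y; apply: val_inj; rewrite /= linearP.
  pose gl : {linear G -> im_mod (d (-1))} :=
    HB.pack g (GRing.isLinear.Build R G (im_mod (d (-1))) *:%R g glin).
  apply: (@tor1_zero_iso_sym _ _ _ gl) (main (-1)).
    by move=> x y /(congr1 val) /inj_i.
  move=> [y hy]; have /asboolP[x e] := hy.
  have : range i y by rewrite ri; exists x.
  by case=> z _ ez; exists z; apply: val_inj.
elim: k n => [|k IH] n; last first.
  apply: (tor1_zero_quot (s n) (cover_ses _) (Free_flat _) (IH _)).
  exact: tor1_zero_flatr.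
apply/(tor1_zeroPr _ (s n) (flatF _)); apply: raddf_inj0 => t.
have [x <-] := tensor_map_surj I (@im_corestr_surj _ _ _ (d (n + 1))) t.
move=> h; have /(exI I injI)[w <-] : tensor_map I (d (n + 1)) x = 0.
  by rewrite -h; symmetry; apply: tensor_map_comp.
apply: tensor_map0 => z; apply: val_inj => /=.
by apply/exd; exists z.
Qed.

Lemma resolution_ker M k G0 (e : {linear G0 -> M}) :
  surj e -> gorenstein_flat G0 -> gorenstein_flat_resolution (ker_mod e) k ->
  gorenstein_flat_resolution M k.+1.
Proof.
move=> se hG0 [G [d [e' [hG zG se' ede' ed]]]].
pose G' i : lmodType R := if i is j.+1 then G j else G0.
pose d' i : {linear G' i.+1 -> G' i} :=
  match i return {linear G' i.+1 -> G' i} with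
  | 0%N => ker_incl e \o e' | j.+1 => d j end.
exists G', d', e.
have [ik ek _] := ker_ses se.
split=> //; try by case.
- move=> y; rewrite ek; split=> [[k' <-]|[x <-]]; last by exists (e' x).
  by have [x <-] := se' k'; exists x.
- case=> [|i] y; [|exact: ed].
  split=> [h|/(ede' y) e0]; last by rewrite /= e0.
  by apply/(ede' y)/ik.
Qed.

(** Each syzygy removed from the injective module is traded for one step of the resolution; the
    kernel of G 0 -> M has a resolution shorter by one. *)
Lemma resolution_tor1 M k j I :
  gorenstein_flat_resolution M k -> (k <= j)%N -> injective_module I ->
  tor1_zero (iter j Omega I) M.
Proof.
elim: k M j => [|k IH] M j [G [d [e [hG zG se ede ed]]]] kj injI.
  have ie : injective e.
    apply: raddf_inj0 => x /ede[y <-].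
    by have -> : y = 0; [exact: (zG 1%N) | rewrite linear0].
  by apply: (tor1_zero_iso ie se); apply: gorenstein_flat_tor1 => //; apply: hG.
case: j kj => // j kj.
have e'P x : d 0%N x \in kerb e by apply/eqP/ede; exists x.
pose e' x : ker_mod e := exist _ (d 0%N x) (e'P x).
have e'lin : linear e' by move=> a x y; apply: val_inj; rewrite /= linearP.
pose e'l : {linear G 1%N -> ker_mod e} :=
  HB.pack e' (GRing.isLinear.Build R (G 1%N) (ker_mod e) *:%R e' e'lin).
have hK : gorenstein_flat_resolution (ker_mod e) k.
  exists (fun i => G i.+1), (fun i => d i.+1), e'l; split=> //.
  - by move=> i ik; apply: hG.
  - by move=> i ik; apply: zG.
  - move=> [y hy]; have /eqP/ede[x ex] := hy; exists x; exact: val_inj.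
  - move=> y; rewrite -ed; split=> [/(congr1 val) //|h]; exact: val_inj.
apply: (tor1_zero_quot (ker_ses se) (cover_ses (iter j Omega I)) (Free_flat _)).
  exact: (IH _ j hK kj injI).
exact: (@gorenstein_flat_tor1 I _ j.+1 injI (hG 0%N isT)).
Qed.

(** One step covers B by Free A x Free C. The kernel is an extension of Omega C by Omega A, and
    since Free A x Free C is flat, [iter_Omega_flat] carries the hypothesis on B over to the n-th
    syzygy of that kernel. *)
Lemma horseshoe n A B C (f : {linear A -> B}) (g : {linear B -> C}) :
  ses f g -> flat (iter n Omega B) ->
  exists F (u : {linear iter n Omega A -> F}) (v : {linear F -> iter n Omega C}),
    flat F /\ ses u v.
Proof.
elim: n A B C f g => [|n IH] A B C f g hfg hB; first by exists B, f, g.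
have [hf efg hg] := hfg.
have [h hh] := Free_lift (cover C) hg.
pose P : lmodType R := (Free A * Free C)%type.
pose p (x : P) : B := f (cover A x.1) + h x.2.
have plin : linear p.
  move=> a x y; rewrite /p /= !linearP scalerDr addrACA; congr (_ + _).
pose pl : {linear P -> B} := HB.pack p (GRing.isLinear.Build R P B *:%R p plin).
have sp : surj pl.
  move=> b; have [c hc] := cover_surj (g b).
  have /efg[a ea] : g (b - h c) = 0 by rewrite linearB hh hc subrr.
  have [a' ea'] := cover_surj a; exists (a', c).
  by rewrite /= /p /= ea' ea subrK.
have gp x : g (pl x) = cover C x.2.
  have gf a : g (f a) = 0 by apply/efg; exists a.
  by rewrite /= /p linearD gf add0r hh.
pose k1 := ker_incl (cover A); pose k2 := ker_incl (cover C).
have uP (x : Omega A) : ((k1 x, 0) : P) \in kerb pl.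
  apply/eqP; rewrite /= /p /= (ker_incl0 (f := cover A)) !linear0.
  by rewrite addr0.
pose u x : ker_mod pl := exist _ ((k1 x, 0) : P) (uP x).
have ulin : linear u.
  move=> a x y; apply: val_inj.
  rewrite [RHS](_ : _ = (a *: k1 x + k1 y, a *: 0 + 0)) // scaler0 addr0.
  by rewrite -linearP.
pose ul : {linear Omega A -> ker_mod pl} :=
  HB.pack u (GRing.isLinear.Build R (Omega A) (ker_mod pl) *:%R u ulin).
have vP (x : ker_mod pl) : (val x).2 \in kerb (cover C).
  by apply/eqP; rewrite -gp (ker_incl0 x) linear0.
pose v x : Omega C := exist _ (val x).2 (vP x).
have vlin : linear v by move=> a x y; apply: val_inj.
pose vl : {linear ker_mod pl -> Omega C} :=
  HB.pack v (GRing.isLinear.Build R (ker_mod pl) (Omega C) *:%R v vlin).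
have huv : ses ul vl.
  split.
  - by move=> x y /(congr1 val) [] /val_inj.
  - move=> y; split=> [/(congr1 val) y20|[x <-]]; last exact: val_inj.
    have y2 : (val y).2 = 0 by exact: y20.
    have := ker_incl0 y; rewrite -[pl _]/(f (cover A (val y).1) + h (val y).2).
    rewrite y2 linear0 addr0 => e.
    have [|z ez] := @ker_inclP _ _ _ (cover A) (val y).1.
      by apply: hf; rewrite e linear0.
    exists z; apply: val_inj; rewrite [RHS]surjective_pairing y2.
    by congr pair.
  (* The lift of [c] to Free C maps under [h] into the image of A; [- a'] in Free A compensates for
     it. *)
  - move=> c; have /efg[a ea] : g (h (k2 c)) = 0 by rewrite hh (ker_incl0 c).
    have [a' ea'] := cover_surj a.
    have hx : ((- a', k2 c) : P) \in kerb pl.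
      by apply/eqP; rewrite /= /p /= linearN ea' linearN ea addNr.
    by exists (exist _ ((- a', k2 c) : P) hx); apply: val_inj.
have fP : flat P.
  pose inl (x : Free A) : P := (x, 0).
  have inllin : linear inl.
    by move=> a x y; rewrite /inl; congr pair; rewrite /= scaler0 addr0.
  pose inll : {linear Free A -> P} :=
    HB.pack inl (GRing.isLinear.Build R (Free A) P *:%R inl inllin).
  have sndlin : linear (fun x : P => x.2) by [].
  pose sndl : {linear P -> Free C} :=
    HB.pack (fun x : P => x.2) (GRing.isLinear.Build R P (Free C) *:%R _ sndlin).
  apply: (@flat_ext _ _ _ _ inll sndl); [|exact: Free_flat|exact: Free_flat].
  split=> [x y [] //|[a c]|c]; last by exists (0, c).
  split=> [/= ->|[x [_ /= <-]] //]; by exists a.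
have /(IH _ _ _ _ _ huv) := proj1 (iter_Omega_flat n (ker_ses sp) fP) hB.
by rewrite -!iterSr.
Qed.

Lemma cosyzygy_exists M : exists C I (i : {linear M -> I}) (p : {linear I -> C}),
  injective_module I /\ ses i p.
Proof.
have [I [i [hI hi]]] := enough_injectives M.
exists (coker_mod i), I, i, (coker_proj i); split=> //; exact: coker_ses.
Qed.

Definition cosyzygy M : lmodType R := projT1 (cid (cosyzygy_exists M)).

Lemma cosyzygy_ses M : exists I (i : {linear M -> I}) (p : {linear I -> cosyzygy M}),
  injective_module I /\ ses i p.
Proof. by rewrite /cosyzygy; case: cid. Qed.

(** * Syzygies when the injectives have bounded flat dimension *)

Section FiniteFlatDimension.
Variable n : nat.
Hypothesis hn : forall I, injective_module I -> flat (iter n Omega I).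

(** [Z] lists the images of the complex sought: syzygies of Omega^n M on one side, n-th syzygies of
    the cosyzygies of M on the other. On the latter side [horseshoe], applied to an injective middle
    term, supplies the flat modules. *)
Lemma iter_Omega_gorenstein_flat M : gorenstein_flat (iter n Omega M).
Proof.
pose Z (z : int) := match z with
  | Posz k => iter k Omega (iter n Omega M)
  | Negz j => iter n Omega (iter j.+1 cosyzygy M)
  end.
have hZ (z : int) : exists F (u : {linear Z (z + 1) -> F}) (v : {linear F -> Z z}),
    flat F /\ ses u v.
  case: z => k.
    rewrite -PoszD addn1.
    exists (Free (iter k Omega (iter n Omega M))), (ker_incl (cover _)), (cover _).
    by split; [exact: Free_flat | exact: cover_ses].
  have -> : Z (Negz k + 1) = iter n Omega (iter k cosyzygy M).
    by case: k => [|k] //; rewrite NegzE -addn1 PoszD opprD addrNK; case: k.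
  have [I [i [p [injI hip]]]] := cosyzygy_ses (iter k cosyzygy M).
  exact: (horseshoe hip (hn injI)).
(* For all z, Tor_{n+1}(I, Z z) = 0 by the bound on I. As Tor_{i+1}(I, Z(z-1)) = 0 implies Tor_i(I,
   Z z) = 0, degree 1 is reached after n steps. *)
suff hT I : injective_module I -> forall j z, (j <= n)%N ->
    tor1_zero (iter (n - j) Omega I) (Z z).
  apply: (@syzygies_gorenstein_flat Z) hZ _ => I z injI.
  by have := hT I injI n z (leqnn n); rewrite subnn.
move=> injI; elim=> [|j IH] z jn.
  by rewrite subn0; apply/tor1_zero_flatl/hn.
have -> : z = z - 1 + 1 by rewrite subrK.
have [F [u [v [fF huv]]]] := hZ (z - 1).
apply: (tor1_zero_sub huv (cover_ses _) (Free_flat _)).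
  exact: tor1_zero_flatr.
by rewrite -[ker_mod _]/(iter (n - j.+1).+1 Omega I) -subSn // subSS; apply/IH/ltnW.
Qed.

End FiniteFlatDimension.

(** The complex is 0 -> P = P -> 0, placed in degrees 0 and -1. *)
Lemma flat_gorenstein_flat P : flat P -> gorenstein_flat P.
Proof.
move=> hP; pose Z (z : int) := if z is Posz 0 then P else zeromod.
have fZ z : flat (Z z) by case: z => [[|k]|k] //; apply/zero_flat/zeromodP.
apply: (@syzygies_gorenstein_flat Z) => [z|I z _]; last exact: tor1_zero_flatr.
case: z => [[|k]|[|k]].
- exists P, \0, idfun; split=> //.
  by apply: zero_ses_l => [|x y //|x]; [exact: zeromodP | exists x].
- exists zeromod, \0, \0; split; first exact/zero_flat/zeromodP.
  apply: zero_ses_l => [|x y _|x]; first exact: zeromodP.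
    by rewrite (zeromodP x) (zeromodP y).
  by exists 0; rewrite (zeromodP x).
- exists P, idfun, \0; split=> //.
  by apply: zero_ses_r => [|x y //|x]; [exact: zeromodP | exists x].
- exists zeromod, \0, \0; split; first exact/zero_flat/zeromodP.
  have zZ : is_zero_module (Z (Negz k.+1 + 1)).
    by rewrite NegzE -addn1 PoszD opprD addrNK; exact: zeromodP.
  apply: zero_ses_l => [|x y _|x]; first exact: zZ.
    by rewrite (zeromodP x) (zeromodP y).
  by exists 0; rewrite (zeromodP x).
Qed.

Lemma gorenstein_flat_resolution0 M : gorenstein_flat M -> gorenstein_flat_resolution M 0.
Proof.
move=> hM; pose G i : lmodType R := if i is 0%N then M else zeromod.
exists G, (fun i => \0), idfun; split.
- by case.
- by case=> // i _; exact: zeromodP.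
- by move=> x; exists x.
- by move=> y; split=> [/= ->|[x <-] //]; exists 0.
- by move=> i y; split=> [_|_] //; exists 0; rewrite (zeromodP y).
Qed.

Lemma iter_Omega_resolution n M :
  gorenstein_flat (iter n Omega M) -> gorenstein_flat_resolution M n.
Proof.
elim: n M => [|n IH] M h; first exact: gorenstein_flat_resolution0.
apply: (resolution_ker (cover_surj (M := M))).
  exact/flat_gorenstein_flat/Free_flat.
by apply: IH; rewrite -/(Omega M) -iterSr.
Qed.

(** From left to right, Tor_{n+1}(I, -) vanishes on every module; from right to left, n free covers
    followed by the Gorenstein flat n-th syzygy form a resolution. *)
Lemma bounded_resolutionsP n :
  (forall M, exists2 k, (k <= n)%N & gorenstein_flat_resolution M k) <->
  (forall I, injective_module I -> flat (iter n Omega I)).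
Proof.
split=> [h I injI|h M].
  by apply: flat_tor1 => M; have [k kn hk] := h M; apply: (resolution_tor1 hk kn).
by exists n => //; apply/iter_Omega_resolution/iter_Omega_gorenstein_flat.
Qed.

End GorensteinFlat.

(** * Modules over the polynomial ring *)

Section Restriction.
Variables (R : comNzRingType) (M : lmodType {poly R}).

(** A separate name for the carrier keeps the action of R apart from that of R[X]. *)
Definition restr : Type := M.

HB.instance Definition _ := GRing.Zmodule.on restr.

Definition restr_scale (r : R) (m : restr) : restr := (r%:P *: (m : M) : M).

Fact restr_scaleA a b v : restr_scale a (restr_scale b v) = restr_scale (a * b) v.
Proof. by rewrite /restr_scale scalerA polyCM. Qed.
Fact restr_scale1 : left_id 1 restr_scale.
Proof. by move=> v; rewrite /restr_scale polyC1 scale1r. Qed.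
Fact restr_scaleDr : right_distributive restr_scale +%R.
Proof. by move=> r u v; rewrite /restr_scale scalerDr. Qed.
Fact restr_scaleDl v : {morph restr_scale^~ v : a b / a + b}.
Proof. by move=> a b; rewrite /restr_scale polyCD scalerDl. Qed.

HB.instance Definition _ := GRing.Zmodule_isLmodule.Build R restr
  restr_scaleA restr_scale1 restr_scaleDr restr_scaleDl.

Lemma restr_scaleE (r : R) (m : M) : r *: (m : restr) = (r%:P *: m : M).
Proof. by []. Qed.

End Restriction.

Section RestrictionMap.
Variables (R : comNzRingType) (M N : lmodType {poly R}) (f : {linear M -> N}).

Definition restr_map : restr M -> restr N := f.

Fact restr_map_linear : linear restr_map.
Proof. by move=> a x y; rewrite /restr_map !restr_scaleE linearP. Qed.

HB.instance Definition _ :=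
  GRing.isLinear.Build R (restr M) (restr N) *:%R restr_map restr_map_linear.

End RestrictionMap.

Lemma poly_linear (R : comNzRingType) (M N : lmodType {poly R}) (f : M -> N) :
  zmod_morphism f -> (forall c m, f (c%:P *: m) = c%:P *: f m) ->
  (forall m, f ('X *: m) = 'X *: f m) -> linear f.
Proof.
move=> fB fC fX.
have f0 : f 0 = 0 by have := fB 0 0; rewrite !subrr.
have fN x : f (- x) = - f x by have := fB 0 x; rewrite f0 !sub0r.
have fD x y : f (x + y) = f x + f y by have := fB x (- y); rewrite fN !opprK.
suff fZ p m : f (p *: m) = p *: f m by move=> a x y; rewrite fD fZ.
elim/poly_ind: p m => [|p c IH] m; first by rewrite !scale0r f0.
by rewrite !scalerDl fD fC -!scalerA IH fX.
Qed.

(* V as an R[X]-module on which X acts by T. *)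
Definition polymod (R : comNzRingType) (V : lmodType R) (T : {linear V -> V}) : Type := V.

Section PolyModule.
Variables (R : comNzRingType) (V : lmodType R) (T : {linear V -> V}).
Local Notation polymod := (polymod T).

HB.instance Definition _ := GRing.Zmodule.on polymod.

Definition poly_scale (p : {poly R}) (v : polymod) : polymod :=
  \sum_(i < size p) p`_i *: iter i T (v : V) : V.

Lemma poly_scaleE n (p : {poly R}) (v : polymod) : (size p <= n)%N ->
  poly_scale p v = (\sum_(i < n) p`_i *: iter i T (v : V) : V).
Proof.
move=> pn; rewrite /poly_scale.
rewrite (big_ord_widen n (fun i => p`_i *: iter i T (v : V))) //.
rewrite big_mkcond; apply: eq_bigr => i _; case: ltnP => // h.
by rewrite nth_default // scale0r.
Qed.

Lemma poly_scaleC c (v : polymod) : poly_scale c%:P v = (c *: (v : V) : V).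
Proof.
by rewrite (@poly_scaleE 1) ?size_polyC_leq1 // big_ord1 coefC.
Qed.

Fact poly_scaleDl v : {morph poly_scale^~ v : p q / p + q}.
Proof.
move=> p q; pose n := maxn (size p) (size q).
rewrite (@poly_scaleE n (p + q)) ?size_polyD //.
rewrite (@poly_scaleE n p) ?leq_maxl // (@poly_scaleE n q) ?leq_maxr //.
by rewrite -big_split; apply: eq_bigr => i _; rewrite coefD scalerDl.
Qed.

Fact poly_scaleDr : right_distributive poly_scale +%R.
Proof.
move=> p u v; rewrite /poly_scale -big_split; apply: eq_bigr => i _ /=.
rewrite -scalerDr; congr (_ *: _).
by elim: (nat_of_ord i) => //= n ->; rewrite linearD.
Qed.

Lemma poly_scaleMX p (v : polymod) : poly_scale (p * 'X) v = poly_scale p (T v).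
Proof.
rewrite (@poly_scaleE (size p).+1); last first.
  by apply: leq_trans (size_polyMleq _ _) _; rewrite size_polyX addn2.
rewrite big_ord_recl coefMX eqxx scale0r add0r; apply: eq_bigr => i _.
by rewrite coefMX /= -iterSr.
Qed.

Lemma poly_scaleT p (v : polymod) : poly_scale p (T v) = T (poly_scale p v).
Proof.
rewrite /poly_scale linear_sum; apply: eq_bigr => i _ /=.
by rewrite linearZ /= -iterSr.
Qed.

Fact poly_scale1 : left_id 1 poly_scale.
Proof. by move=> v; rewrite poly_scaleC scale1r. Qed.

Fact poly_scaleA p q v : poly_scale p (poly_scale q v) = poly_scale (p * q) v.
Proof.
have s0 w : poly_scale 0 w = 0 by rewrite -[0]/(0%:P) poly_scaleC scale0r.
elim/poly_ind: p q v => [|p c IH] q v; first by rewrite mul0r !s0.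
rewrite mulrDl !poly_scaleDl poly_scaleMX -poly_scaleT IH -mulrA ['X * q]mulrC.
rewrite mulrA poly_scaleMX; congr (_ + _).
rewrite poly_scaleC (@poly_scaleE (size q) (c%:P * q)); last first.
  by rewrite mul_polyC size_scale_leq.
rewrite /poly_scale scaler_sumr; apply: eq_bigr => i _.
by rewrite coefCM scalerA.
Qed.

HB.instance Definition _ := GRing.Zmodule_isLmodule.Build {poly R} polymod
  poly_scaleA poly_scale1 poly_scaleDr poly_scaleDl.

Lemma polymodC c (v : polymod) : c%:P *: v = (c *: (v : V) : V).
Proof. exact: poly_scaleC. Qed.

Lemma polymodX (v : polymod) : 'X *: v = (T v : V).
Proof.
by rewrite -['X *: v]/(poly_scale 'X v) -['X]mul1r poly_scaleMX poly_scale1.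
Qed.

Lemma polymodXn n (v : polymod) : 'X^n *: v = (iter n T (v : V) : V).
Proof.
elim: n => [|n IH]; first by rewrite expr0 scale1r.
by rewrite exprS -scalerA IH polymodX.
Qed.

End PolyModule.

(** * The polynomial module N[X] *)

Section FiniteSupport.
Variables (R : comNzRingType) (N : lmodType R).

Definition fsupp_pred : {pred (nat -> N)} :=
  fun f => `[< exists n, forall k, (n <= k)%N -> f k = 0 >].

Fact fsupp_pred_submod_closed : submod_closed fsupp_pred.
Proof.
split; first by apply/asboolP; exists 0%N.
move=> a f g /asboolP[n hn] /asboolP[m hm]; apply/asboolP.
exists (maxn n m) => k; rewrite geq_max => /andP[nk mk].
by rewrite -[LHS]/(a *: f k + g k) hn // hm // scaler0 addr0.
Qed.

HB.instance Definition _ :=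
  GRing.isSubmodClosed.Build R _ fsupp_pred fsupp_pred_submod_closed.

Definition fsupp : lmodType R := submod fsupp_pred.

Definition fs_fun (f : fsupp) : nat -> N := \val f.

Definition mk_fsupp (f : nat -> N) n (h : forall k, (n <= k)%N -> f k = 0) : fsupp :=
  exist (fun f : nat -> N => f \in fsupp_pred) f (asboolT (ex_intro _ n h)).

Lemma fsupp_bound (f : fsupp) : exists n, forall k, (n <= k)%N -> fs_fun f k = 0.
Proof. by case: f => f hf /=; apply/asboolP. Qed.

Lemma fsuppP (f g : fsupp) : (forall k, fs_fun f k = fs_fun g k) -> f = g.
Proof. by move=> e; apply/val_inj/funext. Qed.

Lemma fs_funB (f g : fsupp) k : fs_fun (f - g) k = fs_fun f k - fs_fun g k.
Proof. by []. Qed.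

Lemma fs_funD (f g : fsupp) k : fs_fun (f + g) k = fs_fun f k + fs_fun g k.
Proof. by []. Qed.

Lemma fs_funZ a (f : fsupp) k : fs_fun (a *: f) k = a *: fs_fun f k.
Proof. by []. Qed.

Fact mono_subproof (i : nat) (x : N) k :
  (i.+1 <= k)%N -> (if k == i then x else 0) = 0.
Proof. by case: eqP => // -> /[!ltnn]. Qed.

Definition mono i x : fsupp := mk_fsupp (@mono_subproof i x).

Lemma monoE i x k : fs_fun (mono i x) k = if k == i then x else 0.
Proof. by []. Qed.

Fact mono_linear i : linear (mono i).
Proof.
move=> a x y; apply: fsuppP => k; rewrite fs_funD fs_funZ !monoE.
by case: eqP => // _; rewrite scaler0 addr0.
Qed.

HB.instance Definition _ i :=
  GRing.isLinear.Build R N fsupp *:%R (mono i) (mono_linear i).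

Lemma fsupp_ind (P : fsupp -> Prop) :
  (forall i x, P (mono i x)) -> (forall f g, P f -> P g -> P (f - g)) ->
  forall f, P f.
Proof.
move=> Pm PB f; have [n hn] := fsupp_bound f.
elim: n f hn => [|n IH] f hn.
  rewrite [f](_ : _ = mono 0 0); first exact: Pm.
  by apply: fsuppP => k; rewrite hn // monoE if_same.
have -> : f = (f - mono n (fs_fun f n)) - (mono n (- fs_fun f n)).
  by rewrite linearN opprK subrK.
apply: PB => //; apply: IH => k nk; rewrite fs_funB monoE.
by case: eqP => [->|/eqP ne]; rewrite ?subrr // subr0 hn // ltn_neqAle eq_sym ne.
Qed.

Fact fshift_subproof (f : fsupp) k : ((projT1 (cid (fsupp_bound f))).+1 <= k)%N ->
  (if k is k'.+1 then fs_fun f k' else 0) = 0.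
Proof. by case: cid => n hn /=; case: k => // k; apply: hn. Qed.

Definition fshift f : fsupp := mk_fsupp (@fshift_subproof f).

Lemma fshiftE f k : fs_fun (fshift f) k = if k is k'.+1 then fs_fun f k' else 0.
Proof. by []. Qed.

Fact fshift_linear : linear fshift.
Proof.
move=> a f g; apply: fsuppP => -[|k]; rewrite fs_funD fs_funZ !fshiftE //.
by rewrite scaler0 addr0.
Qed.

HB.instance Definition _ :=
  GRing.isLinear.Build R fsupp fsupp *:%R fshift fshift_linear.

Fact funshift_subproof (f : fsupp) k : (projT1 (cid (fsupp_bound f)) <= k)%N ->
  fs_fun f k.+1 = 0.
Proof. by case: cid => n hn /= nk; apply/hn/leqW. Qed.

Definition funshift f : fsupp := mk_fsupp (@funshift_subproof f).

Lemma fshift_mono i x : fshift (mono i x) = mono i.+1 x.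
Proof. by apply: fsuppP => -[|k]; rewrite fshiftE !monoE. Qed.

Section Sum.
Variables (Z : zmodType) (phi : nat -> N -> Z).
Hypothesis phiB : forall k, zmod_morphism (phi k).

(** The additive map on N[X] whose value at x X^k is [phi k x]. The bound in the sum is a chosen
    one; [fssumE] shows that any bound gives the same value. *)
Definition fssum (f : fsupp) : Z :=
  \sum_(k < projT1 (cid (fsupp_bound f))) phi k (fs_fun f k).

Let phi0 k : phi k 0 = 0.
Proof. by have := phiB k 0 0; rewrite !subrr. Qed.

Lemma fssumE n f : (forall k, (n <= k)%N -> fs_fun f k = 0) ->
  fssum f = \sum_(k < n) phi k (fs_fun f k).
Proof.
rewrite /fssum; case: cid => m hm /= hn.
have aux p q : (p <= q)%N -> (forall k, (p <= k)%N -> fs_fun f k = 0) ->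
    \sum_(k < p) phi k (fs_fun f k) = \sum_(k < q) phi k (fs_fun f k).
  move=> pq hp; rewrite (big_ord_widen q (fun i => phi i (fs_fun f i))) //.
  by rewrite big_mkcond; apply: eq_bigr => i _; case: ltnP => // h; rewrite hp ?phi0.
have [mn|/ltnW nm] := leqP m n; [exact: aux | symmetry; exact: aux].
Qed.

Lemma fssum_mono i x : fssum (mono i x) = phi i x.
Proof.
rewrite (@fssumE i.+1); last exact: mono_subproof.
rewrite big_ord_recr /= monoE eqxx big1 ?add0r // => k _.
by rewrite monoE ltn_eqF.
Qed.

Fact fssum_zmod_morphism : zmod_morphism fssum.
Proof.
move=> f g; have [n hn] := fsupp_bound f; have [m hm] := fsupp_bound g.
have hf k : (maxn n m <= k)%N -> fs_fun f k = 0.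
  by rewrite geq_max => /andP[nk mk]; apply: hn.
have hg k : (maxn n m <= k)%N -> fs_fun g k = 0.
  by rewrite geq_max => /andP[nk mk]; apply: hm.
rewrite (fssumE hf) (fssumE hg) (@fssumE (maxn n m)).
  by rewrite -sumrB; apply: eq_bigr => k _; rewrite fs_funB phiB.
by move=> k h; rewrite fs_funB hf // hg // subrr.
Qed.

End Sum.

(** N[X] by its coefficient sequences, X acting as the shift. *)
Definition polyx : lmodType {poly R} := polymod fshift.

Definition cst0 (x : N) : polyx := mono 0 x.

Lemma polyx_funB (f g : polyx) k : fs_fun (f - g) k = fs_fun f k - fs_fun g k.
Proof. by []. Qed.

Lemma polyxX (f : polyx) : 'X *: f = fshift f.
Proof. exact: polymodX. Qed.

Lemma polyxC c (f : polyx) : c%:P *: f = c *: (f : fsupp).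
Proof. exact: polymodC. Qed.

Lemma polyxXn_cst0 i (x : N) : 'X^i *: cst0 x = mono i x.
Proof.
rewrite polymodXn; elim: i => //= i ->; exact: fshift_mono.
Qed.

End FiniteSupport.

Section PolyxMap.
Variables (R : comNzRingType) (N N' : lmodType R) (g : {linear N -> N'}).

Fact fmap_subproof (f : fsupp N) k : (projT1 (cid (fsupp_bound f)) <= k)%N ->
  g (fs_fun f k) = 0.
Proof. by case: cid => n hn /= nk; rewrite hn // linear0. Qed.

Definition polyx_map (f : polyx N) : polyx N' := mk_fsupp (@fmap_subproof f).

Lemma polyx_mapE f k : fs_fun (polyx_map f) k = g (fs_fun f k).
Proof. by []. Qed.

Fact polyx_map_linear : linear polyx_map.
Proof.
apply: poly_linear => [f h|c f|f].
- by apply: fsuppP => k; rewrite polyx_funB !polyx_mapE polyx_funB linearB.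
- by rewrite !polyxC; apply: fsuppP => k; rewrite fs_funZ !polyx_mapE fs_funZ linearZ.
- rewrite !polyxX; apply: fsuppP => -[|k]; rewrite fshiftE !polyx_mapE fshiftE //.
  exact: linear0.
Qed.

HB.instance Definition _ := GRing.isLinear.Build {poly R} (polyx N) (polyx N') *:%R
  polyx_map polyx_map_linear.

Lemma polyx_map_cst0 x : polyx_map (cst0 x) = cst0 (g x).
Proof.
by apply: fsuppP => k; rewrite polyx_mapE !monoE; case: eqP => // _; rewrite linear0.
Qed.

End PolyxMap.

Lemma polyx_map_inj (R : comNzRingType) (A B : lmodType R) (f : {linear A -> B}) :
  injective f -> injective (polyx_map f).
Proof.
move=> hf x y e; apply: fsuppP => k; apply: hf.
by rewrite -!polyx_mapE e.
Qed.

Lemma polyx_ses (R : comNzRingType) (A B C : lmodType R)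
    (f : {linear A -> B}) (g : {linear B -> C}) :
  ses f g -> ses (polyx_map f) (polyx_map g).
Proof.
move=> [hf efg hg]; split; first exact: polyx_map_inj.
  move=> y; split=> [e|[x <-]]; last first.
    apply: fsuppP => k; rewrite !polyx_mapE; apply/efg.
    by exists (fs_fun x k).
  have /choice[s hs] : forall k, exists a, f a = fs_fun y k.
    by move=> k; apply/efg; rewrite -polyx_mapE e.
  have [n hn] := fsupp_bound y.
  have s0 k : (n <= k)%N -> s k = 0.
    by move=> nk; apply: hf; rewrite hs hn // linear0.
  by exists (mk_fsupp s0); apply: fsuppP => k; rewrite polyx_mapE -hs.
move=> z; have [n hn] := fsupp_bound z.
have /choice[s hs] : forall k, exists b, g b = fs_fun z k /\ ((n <= k)%N -> b = 0).
  move=> k; have [nk|nk] := leqP n k; first by exists 0; rewrite hn // linear0.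
  by have [b eb] := hg (fs_fun z k); exists b.
have s0 k : (n <= k)%N -> s k = 0 by case: (hs k) => _; apply.
by exists (mk_fsupp s0); apply: fsuppP => k; rewrite polyx_mapE -(proj1 (hs k)).
Qed.

(** * The isomorphism between A (x)_R N and A (x)_{R[X]} N[X] *)

Section PolyxTensor.
Variables (R : comNzRingType) (A : lmodType {poly R}) (N : lmodType R).

Definition theta : tensor (restr A) N -> tensor A (polyx N) :=
  tensor_lift (fun (a : restr A) (n : N) => tens (a : A) (cst0 n)).

Let theta_balanced : balanced (fun (a : restr A) (n : N) => tens (a : A) (cst0 n)).
Proof.
split=> [a b n|a m n|r a n]; first exact: tensDl.
  by rewrite -tensDr -[cst0 (m + n)]/(mono 0 (m + n)) linearD.
rewrite restr_scaleE tensZ polyxC -[cst0 (r *: n)]/(mono 0 (r *: n)).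
by rewrite linearZ.
Qed.

Lemma thetaE a n : theta (tens a n) = tens (a : A) (cst0 n).
Proof. exact: tensor_liftE. Qed.

Lemma thetaB s t : theta (s - t) = theta s - theta t.
Proof. exact: tensor_liftB. Qed.

Let psi (a : A) (k : nat) (n : N) : tensor (restr A) N :=
  tens ('X^k *: a : restr A) n.

Let psiB a k : zmod_morphism (psi a k).
Proof. by move=> x y; rewrite /psi tensBr. Qed.

(** It sends a (x) n X^k to X^k a (x) n. *)
Definition theta_inv : tensor A (polyx N) -> tensor (restr A) N :=
  tensor_lift (fun (a : A) (f : polyx N) => fssum (psi a) f).

Let theta_inv_balanced : balanced (fun (a : A) (f : polyx N) => fssum (psi a) f).
Proof.
have sB a f g : fssum (psi a) (f - g) = fssum (psi a) f - fssum (psi a) g.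
  exact: fssum_zmod_morphism.
have s0 a : fssum (psi a) 0 = 0 by have := sB a 0 0; rewrite !subrr.
have sN a f : fssum (psi a) (- f) = - fssum (psi a) f by have := sB a 0 f; rewrite s0 !sub0r.
have sD a f g : fssum (psi a) (f + g) = fssum (psi a) f + fssum (psi a) g.
  by have := sB a f (- g); rewrite sN !opprK.
have psiD a b k n : psi (a + b) k n = psi a k n + psi b k n.
  by rewrite /psi scalerDr; apply: tensDl.
have sDl a b f : fssum (psi (a + b)) f = fssum (psi a) f + fssum (psi b) f.
  rewrite /fssum -big_split; apply: eq_bigr => k _; exact: psiD.
split=> // p a f.
elim/poly_ind: p a f => [|p c IH] a f.
  rewrite !scale0r s0 /fssum big1 // => k _.
  by rewrite /psi scaler0 tens0l.
rewrite !scalerDl sDl sD; congr (_ + _).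
  rewrite -!scalerA -IH polyxX; elim/fsupp_ind: f => [i x|f g hf hg].
    by rewrite fshift_mono !fssum_mono // /psi !scalerA exprSr mulrAC mulrA.
  have -> : fshift (f - g) = fshift f - fshift g by exact: linearB.
  by rewrite !sB hf hg.
elim/fsupp_ind: f => [i x|f g hf hg].
  rewrite polyxC -linearZ !fssum_mono // /psi -tensZ restr_scaleE; congr tens.
  by rewrite !scalerA mulrC.
by rewrite scalerBr !sB hf hg.
Qed.

Lemma theta_invE a f : theta_inv (tens a f) = fssum (psi a) f.
Proof. exact: tensor_liftE. Qed.

Lemma theta_invB s t : theta_inv (s - t) = theta_inv s - theta_inv t.
Proof. exact: tensor_liftB. Qed.

Lemma thetaK : cancel theta theta_inv.
Proof.
apply: tensor_ext => [s t|s t|a n]; rewrite ?thetaB ?theta_invB //.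
by rewrite thetaE theta_invE fssum_mono // /psi expr0 scale1r.
Qed.

Lemma theta_invK : cancel theta_inv theta.
Proof.
apply: tensor_ext => [s t|s t|a f]; rewrite ?theta_invB ?thetaB //.
rewrite theta_invE; elim/fsupp_ind: f => [i x|f g hf hg]; last first.
  by rewrite fssum_zmod_morphism // thetaB hf hg tensBr.
by rewrite fssum_mono // /psi thetaE tensZ polyxXn_cst0.
Qed.

End PolyxTensor.

(** * Flatness and Tor under change of rings *)

Section ChangeOfRings.
Variable R : comNzRingType.
Local Notation Rx := {poly R}.

Lemma theta_mapl (A B : lmodType Rx) (N : lmodType R) (f : {linear A -> B}) t :
  tensor_mapl (polyx N) f (theta t) = theta (tensor_mapl N (restr_map f) t).
Proof.
move: t; apply: tensor_ext => [s t|s t|a n]; rewrite ?(tensor_maplB, thetaB) //.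
by rewrite tensor_maplE !thetaE tensor_maplE.
Qed.

Lemma theta_map (A : lmodType Rx) (N N' : lmodType R) (g : {linear N -> N'}) t :
  tensor_map A (polyx_map g) (theta t) = theta (tensor_map (restr A) g t).
Proof.
move: t; apply: tensor_ext => [s t|s t|a n]; rewrite ?(tensor_mapB, thetaB) //.
by rewrite thetaE !tensor_mapE thetaE -polyx_map_cst0.
Qed.

Lemma tensor_polyx_map_inj (A : lmodType Rx) (N N' : lmodType R) (g : {linear N -> N'}) :
  injective (tensor_map A (polyx_map g)) <-> injective (tensor_map (restr A) g).
Proof.
split=> h s t e.
  by apply: (can_inj (@thetaK _ A N)); apply: h; rewrite !theta_map e.
have E u : theta (tensor_map (restr A) g (theta_inv u)) = tensor_map A (polyx_map g) u.
  exact: etrans (esym (theta_map g (theta_inv u))) (congr1 _ (theta_invK u)).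
apply: (can_inj (@theta_invK _ A N)); apply: h; apply: (can_inj (@thetaK _ A N')).
exact: etrans (E s) (etrans e (esym (E t))).
Qed.

(** Through [theta], tensoring with F[X] over R[X] is tensoring with F over R. *)
Lemma flat_polyx (F : lmodType R) : flat F -> flat (polyx F).
Proof.
move=> hF A B f hf; apply/tensor_mapl_inj => s t e.
have E u : theta (tensor_mapl F (restr_map f) (theta_inv u)) =
    tensor_mapl (polyx F) f u.
  exact: etrans (esym (theta_mapl f (theta_inv u))) (congr1 _ (theta_invK u)).
apply: (can_inj (@theta_invK _ A F)).
apply: (flat_mapl hF (hf : injective (restr_map f))).
apply: (can_inj (@thetaK _ B F)).
exact: etrans (E s) (etrans e (esym (E t))).
Qed.

Lemma flat_restr (P : lmodType Rx) : flat P -> flat (restr P).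
Proof. by move=> hP A B f hf; apply/tensor_polyx_map_inj/hP/polyx_map_inj. Qed.

Lemma restr_flat_tor1 (K : lmodType Rx) (N : lmodType R) :
  flat (restr K) -> tor1_zero K (polyx N).
Proof.
move=> hK; have s := cover_ses N; have [hk _ _] := s.
apply/(tor1_zeroPr K (polyx_ses s) (flat_polyx (Free_flat N))).
exact/tensor_polyx_map_inj/hK.
Qed.

Lemma restr_ses (A B C : lmodType Rx) (f : {linear A -> B}) (g : {linear B -> C}) :
  ses f g -> ses (restr_map f) (restr_map g).
Proof. by []. Qed.

(** Free R[X]-modules restrict to flat R-modules, so syzygies over R[X] restrict to syzygies over R
    formed with flat presentations. *)
Lemma restr_iter_Omega n (K : lmodType Rx) :
  flat (iter n Omega (restr K)) -> flat (restr (iter n Omega K)).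
Proof.
elim: n K => [|n IH] K //.
move=> /(iter_Omega_flat n (restr_ses (cover_ses K)) (flat_restr (Free_flat K))).
by move=> /IH; rewrite -iterSr.
Qed.

(** * The exact sequence 0 -> M[X] -> M[X] -> M -> 0 *)

Section Evaluation.
Variable M : lmodType Rx.

Let pow (k : nat) (m : restr M) : M := 'X^k *: (m : M).

Let powB k : zmod_morphism (pow k).
Proof. by move=> x y; rewrite /pow -scalerBr. Qed.

Definition polyx_ev (f : polyx (restr M)) : M := fssum pow f.

Fact polyx_ev_linear : linear polyx_ev.
Proof.
have sB f g : polyx_ev (f - g) = polyx_ev f - polyx_ev g.
  exact: fssum_zmod_morphism.
apply: poly_linear => [|c f|f]; first exact: sB.
  elim/fsupp_ind: f => [i x|f g hf hg]; last by rewrite scalerBr !sB hf hg scalerBr.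
  rewrite polyxC -linearZ /polyx_ev !fssum_mono // /pow restr_scaleE.
  by rewrite !scalerA mulrC.
elim/fsupp_ind: f => [i x|f g hf hg]; last by rewrite scalerBr !sB hf hg scalerBr.
by rewrite polyxX fshift_mono /polyx_ev !fssum_mono // /pow exprS scalerA.
Qed.

HB.instance Definition _ := GRing.isLinear.Build Rx (polyx (restr M)) M *:%R
  polyx_ev polyx_ev_linear.

Lemma polyx_ev_cst0 m : polyx_ev (cst0 (m : restr M)) = m.
Proof. by rewrite /polyx_ev fssum_mono // /pow expr0 scale1r. Qed.

Lemma polyx_ev_mono i m : polyx_ev (mono i (m : restr M)) = 'X^i *: m.
Proof. by rewrite /polyx_ev fssum_mono. Qed.

Let Xmap : {linear restr M -> restr M} :=
  restr_map (GRing.scale 'X : M -> M).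

(* Multiplication by X - x on M[X], where x is the action of X on M. *)
Definition polyx_rel (f : polyx (restr M)) : polyx (restr M) :=
  'X *: f - polyx_map Xmap f.

Fact polyx_rel_linear : linear polyx_rel.
Proof.
move=> a f g; rewrite /polyx_rel linearP [X in _ - X]linearP scalerBr.
by rewrite opprD addrACA.
Qed.

HB.instance Definition _ := GRing.isLinear.Build Rx (polyx (restr M)) (polyx (restr M)) *:%R
  polyx_rel polyx_rel_linear.

Lemma polyx_relE f k : fs_fun (polyx_rel f) k =
  (if k is k'.+1 then fs_fun f k' else 0) - ('X *: (fs_fun f k : M) : M).
Proof. by rewrite /polyx_rel polyxX polyx_funB fshiftE polyx_mapE. Qed.

Lemma polyx_rel_last f k :
  fs_fun f k.+1 = 0 -> fs_fun (polyx_rel f) k.+1 = fs_fun f k.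
Proof.
move=> e; rewrite polyx_relE e; have -> : 'X *: ((0 : restr M) : M) = 0.
  exact: scaler0.
exact: subr0.
Qed.

Lemma polyx_ev_rel f : polyx_ev (polyx_rel f) = 0.
Proof.
have rB (f1 f2 : polyx (restr M)) : polyx_ev (polyx_rel (f1 - f2)) =
    polyx_ev (polyx_rel f1) - polyx_ev (polyx_rel f2).
  exact: etrans (congr1 _ (linearB polyx_rel f1 f2)) (linearB polyx_ev _ _).
elim/fsupp_ind: f => [i x|f g hf hg]; last by rewrite rB hf hg subrr.
pose m1 : polyx (restr M) := mono i.+1 x.
pose y : M := ('X : Rx) *: (x : M).
pose m2 : polyx (restr M) := mono i (y : restr M).
have -> : polyx_rel (mono i x) = m1 - m2.
  have ifX (b : bool) : 'X *: ((if b then x else 0) : M) = (if b then 'X *: (x : M) else 0).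
    by case: b => //; apply: scaler0.
  apply: fsuppP => k; rewrite polyx_relE polyx_funB.
  by case: k => [|k]; rewrite !monoE ifX.
rewrite linearB; apply/eqP; rewrite subr_eq0; apply/eqP.
apply: etrans (polyx_ev_mono i.+1 x) (etrans _ (esym (polyx_ev_mono i y))).
by rewrite scalerA -exprSr.
Qed.

(** With x the action of X on M, (X - x) f = 0 forces f_k = x f_{k+1}, so f vanishes downwards from
    its top coefficient. Division by the monic X - x reduces any f to the constant [polyx_ev f],
    which gives exactness in the middle. *)
Lemma polyx_ev_ses : ses polyx_rel polyx_ev.
Proof.
split.
- apply: raddf_inj0 => f e; have [n hn] := fsupp_bound f.
  have step k : fs_fun f k = ('X *: (fs_fun f k.+1 : M) : M).
    apply/eqP; rewrite -subr_eq0; apply/eqP.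
    by rewrite -[LHS](polyx_relE f k.+1) [polyx_rel f]e.
  apply: fsuppP => k; rewrite -[RHS]/0.
  have : (n <= n + k)%N by rewrite leq_addr.
  have : (k <= n + k)%N by rewrite leq_addl.
  have aux j i : (n <= i + j)%N -> fs_fun f i = 0.
    elim: j i => [|j IH] i; first by rewrite addn0; apply: hn.
    by rewrite -addSnnS => /IH h; rewrite step h scaler0.
  by move=> _ _; apply: (aux n); rewrite leq_addl.
- have main n (f : polyx (restr M)) : (forall k, (n <= k)%N -> fs_fun f k = 0) ->
      exists g, f - polyx_rel g = cst0 (polyx_ev f : restr M).
    elim: n f => [|n IH] f hf.
      have -> : f = 0 by apply: fsuppP => k; apply: hf.
      exists 0; rewrite [polyx_rel 0]linear0 subr0 [polyx_ev 0]linear0.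
      by symmetry; apply: (linear0 (mono 0)).
    case: n IH hf => [|n] IH hf.
      have -> : f = cst0 (fs_fun f 0%N).
        by apply: fsuppP => -[|k]; rewrite monoE //= hf.
      exists 0; rewrite [polyx_ev _]polyx_ev_cst0 [polyx_rel 0]linear0.
      exact: subr0.
    (* Here f has degree at most n+1, and subtracting (X - x) g0 cancels its coefficient of
       X^(n+1). *)
    pose g0 : polyx (restr M) := mono n (fs_fun f n.+1).
    have [|g hg] := IH (f - polyx_rel g0).
      case=> // k nk; rewrite -[LHS]/(fs_fun f k.+1 - fs_fun (polyx_rel g0) k.+1).
      rewrite polyx_rel_last; last by rewrite monoE gtn_eqF.
      rewrite monoE; have [->|kn] := eqVneq k n; first exact: subrr.
      rewrite hf; first exact: subr0.
      by rewrite ltnS ltn_neqAle eq_sym kn.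
    exists (g0 + g); rewrite [polyx_rel (g0 + g)](linearD polyx_rel) opprD addrA.
    apply: etrans hg (congr1 (@cst0 _ _) _).
    by apply: etrans (linearB polyx_ev _ _) _; rewrite /= polyx_ev_rel subr0.
  move=> f; split=> [e|[g <-]]; last exact: polyx_ev_rel.
  have [n hn] := fsupp_bound f; have [g hg] := main n f hn.
  exists g; symmetry; apply/eqP; rewrite -subr_eq0 hg [polyx_ev f]e.
  by apply/eqP; rewrite -[LHS]/(mono 0 0) linear0.
- by move=> m; exists (cst0 (m : restr M)); apply: polyx_ev_cst0.
Qed.

End Evaluation.
End ChangeOfRings.

(** * Comparison of flat dimensions over R and R[X] *)

Section PolynomialSyzygies.
Variable R : comNzRingType.
Local Notation Rx := {poly R}.

Lemma cst0_linear (N : lmodType R) a (x y : N) :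
  cst0 (a *: x + y) = a%:P *: cst0 x + cst0 y.
Proof. by rewrite polyxC; apply: (linearP (mono 0)). Qed.

(** An R-linear map A -> J induces A[X] -> J by evaluation; this extends to B[X], and the extension
    is restricted to constants. *)
Lemma restr_injective (J : lmodType Rx) :
  injective_module J -> injective_module (restr J).
Proof.
move=> hJ A B i f inj_i.
pose F : {linear polyx A -> J} := @polyx_ev R J \o polyx_map f.
have [g hg] := hJ _ _ (polyx_map i) F (polyx_map_inj inj_i).
pose h (b : B) : restr J := g (cst0 b).
have hlin : linear h.
  by move=> a x y; rewrite /h cst0_linear linearP.
pose hl : {linear B -> restr J} :=
  HB.pack h (GRing.isLinear.Build R B (restr J) *:%R h hlin).
exists hl => a; apply: etrans (congr1 g (esym (polyx_map_cst0 i a))) _.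
apply: etrans (hg _) _.
exact: etrans (congr1 _ (polyx_map_cst0 f a)) (polyx_ev_cst0 _).
Qed.

(** Tor_{n+2}(J, M) over R[X] lies between Tor_{n+2}(J, M[X]) and Tor_{n+1}(J, M[X]), both of which
    are Tor groups over R and vanish. *)
Lemma poly_flat_dimension_le n :
  (forall I : lmodType R, injective_module I -> flat (iter n Omega I)) ->
  forall J : lmodType Rx, injective_module J -> flat (iter n.+1 Omega J).
Proof.
move=> h J injJ; have hn := h _ (restr_injective injJ).
have hn1 : flat (iter n.+1 Omega (restr J)) by apply: flat_Omega.
apply: flat_tor1 => M.
apply: (tor1_zero_quot (polyx_ev_ses M) (cover_ses (iter n Omega J)) (Free_flat _)).
  exact/restr_flat_tor1/restr_iter_Omega.
exact/(@restr_flat_tor1 _ (iter n.+1 Omega J))/restr_iter_Omega.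
Qed.

Definition triv (N : lmodType R) : lmodType Rx := polymod (\0 : {linear N -> N}).

Section TrivMap.
Variables (N N' : lmodType R) (f : {linear N -> N'}).

Definition triv_map : triv N -> triv N' := f.

Fact triv_map_linear : linear triv_map.
Proof.
apply: poly_linear => [x y|c x|x]; first exact: linearB.
  by rewrite !polymodC; apply: linearZ.
by rewrite !polymodX; apply: linear0.
Qed.

HB.instance Definition _ := GRing.isLinear.Build Rx (triv N) (triv N') *:%R
  triv_map triv_map_linear.

End TrivMap.

Lemma triv_ses (A B C : lmodType R) (f : {linear A -> B}) (g : {linear B -> C}) :
  ses f g -> ses (triv_map f) (triv_map g).
Proof. by []. Qed.

Lemma flat_restr_triv (P : lmodType R) : flat P -> flat (restr (triv P)).
Proof.
pose h (x : P) : restr (triv P) := x.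
have hlin : linear h.
  by move=> a x y; rewrite restr_scaleE polymodC.
pose hl : {linear P -> restr (triv P)} :=
  HB.pack h (GRing.isLinear.Build R P (restr (triv P)) *:%R h hlin).
by apply: (@flat_iso _ _ _ hl) => // x; exists x.
Qed.

(** The sequence 0 -> P[X] -> P[X] -> P -> 0 shows that P has flat dimension at most 1 over R[X], so
    Tor_2(J, P) = 0. *)
Lemma tor1_triv_flat (J : lmodType Rx) (P : lmodType R) :
  flat P -> tor1_zero (Omega J) (triv P).
Proof.
move=> /flat_restr_triv hP.
apply: (tor1_zero_quot (polyx_ev_ses (triv P)) (cover_ses J) (Free_flat _));
  exact/tor1_zero_flatr/flat_polyx.
Qed.

(** Turns Tor_{n+2}(J, M) = 0 into Tor_2(J, Omega^n M) = 0, with syzygies over R: the free R-modules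
    crossed on the way contribute nothing by [tor1_triv_flat]. *)
Lemma tor1_triv_iter_Omega n (J : lmodType Rx) (M : lmodType R) :
  tor1_zero (iter n.+1 Omega J) (triv M) ->
  tor1_zero (Omega J) (triv (iter n Omega M)).
Proof.
elim: n M => [|n IH] M h; [exact: h | rewrite iterSr; apply: IH].
apply: (tor1_zero_sub (triv_ses (cover_ses M)) (cover_ses (iter n.+1 Omega J)) (Free_flat _)) h.
exact/tor1_triv_flat/Free_flat.
Qed.

(** * The injective R[X]-module Hom_R(R[X], I) *)

Section Coinduction.
Variable I : lmodType R.

Definition seq_shift (f : nat -> I) : nat -> I := fun k => f k.+1.

Fact seq_shift_linear : linear seq_shift.
Proof. by []. Qed.

HB.instance Definition _ := GRing.isLinear.Build R (nat -> I) (nat -> I) *:%R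
  seq_shift seq_shift_linear.

(* The coinduced module Hom_R(R[X], I). *)
Definition copoly : lmodType Rx := polymod seq_shift.

Definition copoly_fun (f : copoly) : nat -> I := f.

Lemma copolyX (f : copoly) k : copoly_fun ('X *: f) k = copoly_fun f k.+1.
Proof. by rewrite polymodX. Qed.

Lemma copolyC c (f : copoly) k : copoly_fun (c%:P *: f) k = c *: copoly_fun f k.
Proof. by rewrite polymodC. Qed.

Lemma copolyXn n (f : copoly) k : copoly_fun ('X^n *: f) k = copoly_fun f (k + n).
Proof.
elim: n k => [|n IH] k; first by rewrite expr0 scale1r addn0.
by rewrite exprS -scalerA copolyX IH addSnnS.
Qed.

(** The coefficient at 0 identifies R[X]-linear maps into [copoly] with R-linear maps into I; an
    extension [g0] of the latter yields b |-> (g0 (X^k b))_k. *)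
Lemma copoly_injective : injective_module I -> injective_module copoly.
Proof.
move=> injI A B i f inj_i.
pose f0 (a : restr A) : I := copoly_fun (f a) 0.
have f0lin : linear f0.
  move=> c x y; rewrite /f0 restr_scaleE linearP.
  by rewrite -[LHS]/(copoly_fun (c%:P *: f x) 0 + copoly_fun (f y) 0) copolyC.
pose f0l : {linear restr A -> I} :=
  HB.pack f0 (GRing.isLinear.Build R (restr A) I *:%R f0 f0lin).
have [g0 hg0] := injI _ _ (restr_map i) f0l (inj_i : injective (restr_map i)).
pose g (b : B) : copoly := (fun k => g0 ('X^k *: b : restr B)).
have glin : linear g.
  apply: poly_linear => [x y|c x|x]; apply/funext => k.
  - rewrite -[RHS]/(g0 _ - g0 _) -linearB; congr (g0 _).
    exact: (scalerBr ('X^k) x y).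
  - rewrite -[RHS]/(copoly_fun _ k) copolyC.
    apply: etrans _ (linearZ_LR g0 c ('X^k *: x : restr B)); congr (g0 _).
    by rewrite restr_scaleE !scalerA mulrC.
  - rewrite -[RHS]/(copoly_fun _ k) copolyX /copoly_fun /g; congr (g0 _).
    by rewrite scalerA exprSr.
pose gl : {linear B -> copoly} :=
  HB.pack g (GRing.isLinear.Build Rx B copoly *:%R g glin).
exists gl => a; apply/funext => k.
rewrite -[LHS]/(g0 ('X^k *: i a : restr B)) -linearZ.
apply: etrans (hg0 ('X^k *: a : restr A)) _.
rewrite /= /f0 linearZ; exact: copolyXn.
Qed.

Definition copoly_incl (i : I) : copoly := fun k => if k is 0%N then i else 0.

Lemma copoly_incl_linear a x y :
  copoly_incl (a *: x + y) = a%:P *: copoly_incl x + copoly_incl y.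
Proof.
apply/funext => k.
rewrite -[RHS]/(copoly_fun (a%:P *: copoly_incl x) k + copoly_incl y k) copolyC.
by case: k => [|k] //=; rewrite scaler0 addr0.
Qed.

Lemma copoly_inclX x : 'X *: copoly_incl x = 0.
Proof. by apply/funext => k; rewrite -[LHS]/(copoly_fun _ k) copolyX. Qed.

Section InclTensor.
Variable N : lmodType R.

Definition tensor_incl : tensor I N -> tensor copoly (polyx N) :=
  tensor_lift (fun i n => tens (copoly_incl i) (cst0 n)).

Let tensor_incl_balanced : balanced (fun i n => tens (copoly_incl i) (@cst0 R N n)).
Proof.
have cD n n' : @cst0 R N (n + n') = cst0 n + cst0 n'.
  by rewrite -[n in LHS]scale1r cst0_linear polyC1 scale1r.
have c0 : @cst0 R N 0 = 0 by apply: (addrI (cst0 0)); rewrite -cD !addr0.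
have cZ r n : @cst0 R N (r *: n) = r%:P *: cst0 n.
  by rewrite -[r *: n]addr0 cst0_linear c0 addr0.
have iD x y : copoly_incl (x + y) = copoly_incl x + copoly_incl y.
  by rewrite -[x in LHS]scale1r copoly_incl_linear polyC1 scale1r.
have i0 : copoly_incl 0 = 0 by apply: (addrI (copoly_incl 0)); rewrite -iD !addr0.
split=> [x y n|x n n'|r x n]; rewrite ?iD ?cD ?tensDl ?tensDr //.
rewrite cZ -tensZ; congr tens.
by rewrite -[r *: x]addr0 copoly_incl_linear i0 addr0.
Qed.

Lemma tensor_inclE i n : tensor_incl (tens i n) = tens (copoly_incl i) (cst0 n).
Proof. exact: tensor_liftE. Qed.

Lemma tensor_inclB s t : tensor_incl (s - t) = tensor_incl s - tensor_incl t.
Proof. exact: tensor_liftB. Qed.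

(** The coefficient at 0 is an R-linear retraction of [copoly] onto I; combined with [theta_inv] it
    gives a left inverse. *)
Lemma tensor_incl_inj : injective tensor_incl.
Proof.
pose ev0 (f : restr copoly) : I := copoly_fun f 0.
have ev0lin : linear ev0.
  move=> c x y; rewrite restr_scaleE /ev0.
  by rewrite -[LHS]/(copoly_fun (c%:P *: (x : copoly)) 0 + copoly_fun y 0) copolyC.
pose ev0l : {linear restr copoly -> I} :=
  HB.pack ev0 (GRing.isLinear.Build R (restr copoly) I *:%R ev0 ev0lin).
apply: (can_inj (g := fun t => tensor_mapl N ev0l (theta_inv t))).
apply: tensor_ext => [s t|s t|i n] //.
  by rewrite tensor_inclB theta_invB tensor_maplB.
rewrite tensor_inclE; apply: etrans (congr1 _ (congr1 _ (esym (thetaE _ _)))) _.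
exact: etrans (congr1 _ (thetaK _)) (tensor_maplE _ _ _).
Qed.

End InclTensor.

(** Multiplication by X is injective on R[X], so flatness would make it injective on [copoly]; yet
    it kills the copy of I. *)
Lemma copoly_not_flat (i : I) : flat copoly -> i = 0.
Proof.
move=> hJ.
pose Xm : {linear polyx R^o -> polyx R^o} := GRing.scale 'X.
have iX : injective Xm.
  apply: raddf_inj0 => f e; apply: fsuppP => k.
  have := congr1 (fun h : polyx R^o => fs_fun h k.+1) e.
  by rewrite /= polyxX fshiftE.
have e0 : tens (copoly_incl i) (cst0 (1 : R^o)) = 0.
  apply: (hJ _ _ _ iX); rewrite tensor_mapE raddf0.
  by rewrite -[Xm _]/('X *: _) -tensZ copoly_inclX tens0l.
have e1 : tens i (1 : R^o) = 0.
  apply: tensor_incl_inj; rewrite tensor_inclE e0.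
  by have := tensor_inclB (0 : tensor I R^o) 0; rewrite !subrr.
have bal : balanced (fun (x : I) (r : R^o) => (r : R) *: x).
  split=> [x y r|x r s|r x s]; rewrite ?scalerDr ?scalerDl //.
  by rewrite scalerA mulrC.
have := tensor_liftE bal i 1; rewrite e1 scale1r => <-.
by have := tensor_liftB bal 0 0; rewrite !subrr.
Qed.

End Coinduction.

(** * A presentation of the kernel of Q[X] -> N *)

Section KernelPresentation.
Variables (L Q N : lmodType R) (l : {linear L -> Q}) (q : {linear Q -> N}).
Hypothesis hlq : ses l q.

(** Sets X to 0 and passes to N = Q / L; the kernel is X Q[X] + L[X]. *)
Definition polyx_aug (f : polyx Q) : triv N := q (fs_fun f 0).

Fact polyx_aug_linear : linear polyx_aug.
Proof.
apply: poly_linear => [f g|c f|f].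
- by rewrite /polyx_aug polyx_funB linearB.
- by rewrite [RHS]polymodC /polyx_aug polyxC fs_funZ linearZ.
- by rewrite [RHS]polymodX /polyx_aug polyxX fshiftE linear0.
Qed.

HB.instance Definition _ := GRing.isLinear.Build Rx (polyx Q) (triv N) *:%R
  polyx_aug polyx_aug_linear.

Lemma polyx_aug_surj : surj polyx_aug.
Proof.
move=> x; have [_ _ sq] := hlq; have [y hy] := sq x.
by exists (cst0 y).
Qed.

Definition aug_pair : lmodType Rx := (polyx Q * polyx L)%type.

Definition aug_in (f : polyx L) : aug_pair := (polyx_map l f, (- 'X) *: f).

Fact aug_in_linear : linear aug_in.
Proof.
move=> c f g.
have e1 : polyx_map l (c *: f + g) = c *: polyx_map l f + polyx_map l g.
  exact: linearP.
have e2 : (- 'X) *: (c *: f + g) = c *: ((- 'X) *: f) + (- 'X) *: g.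
  by rewrite scalerDr !scalerA mulrC.
by rewrite /aug_in e1 e2.
Qed.

HB.instance Definition _ := GRing.isLinear.Build Rx (polyx L) aug_pair *:%R
  aug_in aug_in_linear.

Definition aug_sum (x : aug_pair) : polyx Q := 'X *: x.1 + polyx_map l x.2.

Lemma aug_sumE x k : fs_fun (aug_sum x) k =
  (if k is k'.+1 then fs_fun x.1 k' else 0) + l (fs_fun x.2 k).
Proof. by rewrite /aug_sum polyxX. Qed.

Fact aug_sum_linear : linear aug_sum.
Proof.
move=> c x y.
have e1 : polyx_map l (c *: x.2 + y.2) = c *: polyx_map l x.2 + polyx_map l y.2.
  exact: linearP.
have e2 : 'X *: (c *: x.1 + y.1) = c *: ('X *: x.1) + 'X *: y.1.
  by rewrite scalerDr !scalerA mulrC.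
by rewrite /aug_sum /= e1 e2 scalerDr addrACA.
Qed.

Lemma aug_sum_ker x : aug_sum x \in kerb polyx_aug.
Proof.
have [_ elq _] := hlq.
by apply/eqP; rewrite /= /polyx_aug aug_sumE add0r; apply/elq; exists (fs_fun x.2 0).
Qed.

Definition aug_out x : ker_mod polyx_aug := exist _ (aug_sum x) (aug_sum_ker x).

Fact aug_out_linear : linear aug_out.
Proof. move=> c x y; apply: val_inj; exact: aug_sum_linear. Qed.

HB.instance Definition _ := GRing.isLinear.Build Rx aug_pair (ker_mod polyx_aug) *:%R
  aug_out aug_out_linear.

Lemma aug_sum_in f : aug_sum (aug_in f) = 0.
Proof.
have e : polyx_map l ((- 'X) *: f) = (- 'X) *: polyx_map l f by exact: linearZ_LR.
by rewrite /aug_sum /aug_in e [X in _ + X]scaleNr; apply: subrr.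
Qed.

Lemma aug_exact (x : aug_pair) : aug_sum x = 0 -> exists f, aug_in f = x.
Proof.
case: x => f g e; have [il _ _] := hlq.
have e' k : (if k is k'.+1 then fs_fun f k' else 0) + l (fs_fun g k) = 0.
  by rewrite -(aug_sumE (f, g)) e.
have g0 : fs_fun g 0 = 0.
  by apply: il; have := e' 0%N; rewrite add0r linear0.
(* The constant coefficient of X f + l g is l g_0, so g_0 = 0 and g = X g' with g' = [funshift g];
   then f = - l g', and - g' is the preimage. *)
exists (- (funshift g : polyx L)).
have e1 : polyx_map l (- (funshift g : polyx L)) = f.
  apply: fsuppP => k; rewrite polyx_mapE.
  rewrite -[fs_fun _ k]/(- fs_fun g k.+1) linearN.
  by apply/eqP; rewrite eq_sym -addr_eq0; apply/eqP/(e' k.+1).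
have e2 : (- 'X) *: (- (funshift g : polyx L)) = g.
  rewrite scaleNr scalerN opprK polyxX; apply: fsuppP => -[|k].
    by rewrite g0.
  by [].
by rewrite /aug_in e1 e2.
Qed.

Lemma aug_ses : ses aug_in aug_out.
Proof.
have [il elq sq] := hlq; split.
- by move=> f g /(congr1 fst) e; apply: (polyx_map_inj il); exact: e.
- move=> x; split=> [/(congr1 val)|[f <-]]; first exact: aug_exact.
  exact/val_inj/aug_sum_in.
- move=> h; have /elq[z ez] : q (fs_fun (val h) 0) = 0 by apply: ker_incl0 h.
  (* The constant coefficient of h comes from L, and the remainder is X times [funshift (val h)]. *)
  exists (funshift (val h), cst0 z); apply: val_inj; apply: fsuppP => k.
  apply: etrans (aug_sumE _ _) _; rewrite /= monoE.
  case: k => [|k] /=; first by rewrite add0r.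
  by rewrite [l 0]linear0 addr0.
Qed.

End KernelPresentation.

(* For N = Q / L, the kernel K of Q[X] -> N is the quotient of Q[X] x L[X] by
   f |-> (f, - X f) on L[X], and Tor_1(Omega J, N) = 0 iff Tor_1(J, K) = 0, so
   that J (x) L[X] embeds into J (x) (Q[X] x L[X]).  As X kills I, the second
   component vanishes on I (x) L, which hence embeds into I (x) Q. *)
Lemma tor1_copoly (I N : lmodType R) :
  tor1_zero (Omega (copoly I)) (triv N) -> tor1_zero I N.
Proof.
pose l := ker_incl (cover N).
have s : ses l (cover N) := cover_ses N.
move=> /(tor1_zero_balance (cover_ses (copoly I)) (Free_flat _)
  (ker_ses (polyx_aug_surj s)) (flat_polyx (Free_flat N))) hT.
have ial : injective (tensor_map (copoly I) (aug_in l)) := hT _ _ _ _ (aug_ses s).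
apply/(tor1_zeroPr I s (Free_flat N)).
pose in1 (x : polyx (Free N)) : aug_pair (Omega N) (Free N) := (x, 0).
have in1lin : linear in1.
  by move=> c x y; rewrite /in1; congr pair; rewrite /= scaler0 addr0.
pose in1l : {linear polyx (Free N) -> aug_pair (Omega N) (Free N)} :=
  HB.pack in1 (GRing.isLinear.Build Rx _ _ *:%R in1 in1lin).
have key u : tensor_map (copoly I) (aug_in l) (tensor_incl u) =
    tensor_map (copoly I) in1l (tensor_incl (tensor_map I l u)).
  move: u; apply: tensor_ext => [s' t|s' t|i n].
  - by rewrite tensor_inclB tensor_mapB.
  - by rewrite !(tensor_mapB, tensor_inclB).
  rewrite [tensor_map I l _]tensor_mapE !tensor_inclE !tensor_mapE -polyx_map_cst0.
  have e : aug_in l (cst0 n) =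
      in1l (polyx_map l (cst0 n)) + 'X *: (0, - cst0 n).
    rewrite /aug_in scaleNr -scalerN
      -[RHS]/(polyx_map l (cst0 n) + 'X *: 0, 0 + 'X *: (- cst0 n : polyx (Omega N))).
    by rewrite scaler0 addr0 add0r.
  apply: etrans (congr1 (tens (copoly_incl i)) e) _.
  by rewrite tensDr -tensZ copoly_inclX tens0l addr0.
move=> x y e; apply/tensor_incl_inj/ial.
by rewrite !key e.
Qed.

End PolynomialSyzygies.

(** * Dimensions *)

Section PolynomialDimension.
Variable R : comNzRingType.

(** With J = Hom_R(R[X], I), the vanishing passes from Tor_{n+2}(J, M) to Tor_2(J, Omega^n M) over
    R[X], then to Tor_1(I, Omega^n M) over R, which is Tor_{n+1}(I, M). *)
Lemma flat_dimension_le_poly n :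
  (forall J : lmodType {poly R}, injective_module J -> flat (iter n.+1 Omega J)) ->
  forall I : lmodType R, injective_module I -> flat (iter n Omega I).
Proof.
move=> h I injI; apply: flat_tor1 => M.
apply/iter_Omega_tor1/tor1_copoly/tor1_triv_iter_Omega/tor1_zero_flatl/h.
exact: copoly_injective.
Qed.

(** Excludes the bound 0 for R[X]: for an injective I containing R, flatness of Hom_R(R[X], I) would
    force 1 = 0. *)
Lemma poly_injective_not_flat :
  ~ (forall J : lmodType {poly R}, injective_module J -> flat J).
Proof.
move=> h; have [I [i [injI inj_i]]] := enough_injectives (R^o : lmodType R).
have i1 : i (1 : R^o) = 0 by apply/copoly_not_flat/h/copoly_injective.
have /inj_i e : i (1 : R^o) = i 0 by rewrite linear0.
by have := oner_neq0 R; rewrite e eqxx.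
Qed.

End PolynomialDimension.

(** * From bounds to infima and suprema in [\bar int] *)

Section Dimensions.
Variable R : comNzRingType.
Implicit Type M : lmodType R.
Local Open Scope classical_set_scope.

Lemma Gfd_nonzero M : ~ is_zero_module M ->
  (Gfd M = +oo%E /\ forall k, ~ gorenstein_flat_resolution M k) \/
  exists k : nat, [/\ Gfd M = k%:Z%:E, gorenstein_flat_resolution M k &
    forall j, gorenstein_flat_resolution M j -> (k <= j)%N].
Proof.
move=> nz; rewrite /Gfd asboolF //.
have [[k0 hk0]|no] := pselect (exists k, gorenstein_flat_resolution M k); last first.
  left; split; last by move=> k hk; apply: no; exists k.
  (* The set of lengths is empty, so the infimum takes its default value +oo. *)
  rewrite /infimum ifT //; apply/eqP/seteqP; split=> // x [k hk _].
  by apply: no; exists k.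
right; have ex : exists k, `[< gorenstein_flat_resolution M k >].
  by exists k0; apply/asboolP.
case: (ex_minnP ex) => k /asboolP hk mink.
have mink' j : gorenstein_flat_resolution M j -> (k <= j)%N.
  by move=> hj; apply/mink/asboolP.
exists k; split=> //; rewrite /infimum ifF; last first.
  by apply/negbTE/set0P; exists k%:Z%:E; exists k.
apply: xget_subset1; last exact: is_subset1_infimums.
split; first by move=> _ [j hj <-]; rewrite lee_fin lez_nat; apply: mink'.
by move=> y; apply; exists k.
Qed.

Lemma Gfd_leP M (n : nat) : (Gfd M <= n%:Z%:E)%E <->
  exists2 k, (k <= n)%N & gorenstein_flat_resolution M k.
Proof.
have [z|nz] := pselect (is_zero_module M).
  rewrite /Gfd asboolT // leNye; split=> // _; exists 0%N => //.
  exact/gorenstein_flat_resolution0/flat_gorenstein_flat/zero_flat.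
have [[-> no]|[k [-> hk mink]]] := Gfd_nonzero nz.
  by split=> // -[k _ /no].
rewrite lee_fin lez_nat; split=> [kn|[j jn /mink kj]]; first by exists k.
exact: leq_trans kj jn.
Qed.

Lemma Gfd_ge0 M : ~ is_zero_module M -> (0 <= Gfd M)%E.
Proof.
by move=> nz; have [[-> _]|[k [-> _ _]]] := Gfd_nonzero nz; rewrite ?leey.
Qed.

Lemma ring_nonzero : ~ is_zero_module (R^o : lmodType R).
Proof. by move=> /(_ (1 : R)) /eqP; rewrite oner_eq0. Qed.

Definition Gfd_bounded (n : nat) : Prop := forall M, (Gfd M <= n%:Z%:E)%E.

Lemma Gfd_boundedP n : Gfd_bounded n <->
  forall I : lmodType R, injective_module I -> flat (iter n Omega I).
Proof.
rewrite -bounded_resolutionsP; split=> h M; first by have /Gfd_leP := h M.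
exact/Gfd_leP.
Qed.

Lemma Gwdim_bounded (n : nat) :
  Gfd_bounded n -> (forall m, Gfd_bounded m -> (n <= m)%N) -> Gwdim R = n%:Z%:E.
Proof.
move=> hn minn; rewrite /Gwdim /supremum ifF; last first.
  by apply/negbTE/set0P; exists (Gfd (R^o : lmodType R)), (R^o : lmodType R).
apply: xget_subset1; last exact: is_subset1_supremums.
split=> [_ [M ->] //|y uby].
(* The nonzero module R has nonnegative dimension, so an upper bound y can only be a natural number
   or +oo. *)
have y0 : (0 <= y)%E.
  by apply: le_trans (Gfd_ge0 ring_nonzero) (uby _ _); exists (R^o : lmodType R).
case: y y0 uby => [[z|z]| |] // _ uby.
by rewrite lee_fin lez_nat; apply: minn => M; apply: uby; exists M.
Qed.

Lemma Gwdim_unbounded : (forall n, ~ Gfd_bounded n) -> Gwdim R = +oo%E.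
Proof.
move=> no; rewrite /Gwdim /supremum ifF; last first.
  by apply/negbTE/set0P; exists (Gfd (R^o : lmodType R)), (R^o : lmodType R).
apply: xget_subset1; last exact: is_subset1_supremums.
split=> [x _|y uby]; first exact: leey.
have y0 : (0 <= y)%E.
  by apply: le_trans (Gfd_ge0 ring_nonzero) (uby _ _); exists (R^o : lmodType R).
case: y y0 uby => [[z|z]| |] // _ uby.
by case: (no z) => M; apply: uby; exists M.
Qed.

End Dimensions.

(** The bounds for R[X] are exactly the successors of those for R, since 0 is excluded; so the least
    bounds differ by one, or neither exists and both sides are +oo. *)
Lemma Gwdim_poly (R : comNzRingType) : Gwdim {poly R} = (Gwdim R + 1)%E.
Proof.
have step n : Gfd_bounded {poly R} n.+1 <-> Gfd_bounded R n.
  rewrite !Gfd_boundedP; split; first exact: flat_dimension_le_poly.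
  exact: poly_flat_dimension_le.
have no0 : ~ Gfd_bounded {poly R} 0.
  by move=> /Gfd_boundedP; apply: poly_injective_not_flat.
have [[n0 hn0]|no] := pselect (exists n, Gfd_bounded R n); last first.
  have noR n : ~ Gfd_bounded R n by move=> hn; apply: no; exists n.
  rewrite (Gwdim_unbounded noR) Gwdim_unbounded // => -[|n] //.
  by move=> /step; apply: noR.
have ex : exists n, `[< Gfd_bounded R n >] by exists n0; apply/asboolP.
case: (ex_minnP ex) => n /asboolP hn minn.
rewrite (@Gwdim_bounded R n) //; last by move=> m hm; apply/minn/asboolP.
rewrite (@Gwdim_bounded {poly R} n.+1) ?step //; first by rewrite -addn1 PoszD EFinD.
by case=> [//|m] /step hm; rewrite ltnS; apply/minn/asboolP.
Qed.

(** Every module over the zero ring is zero, of dimension -oo. *)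
Lemma Gwdim_trivial (R : comPzRingType) : 1 = 0 :> R -> Gwdim R = -oo%E.
Proof.
move=> e; have z (M : lmodType R) : Gfd M = -oo%E.
  by rewrite /Gfd asboolT // => x; rewrite -[x]scale1r e scale0r.
rewrite /Gwdim (_ : [set x | _]%classic = [set -oo%E]%classic) ?supremum1 //.
apply/seteqP; split=> [x [M ->]|x ->]; first exact: z.
by exists (R^o : lmodType R); rewrite z.
Qed.

Theorem theorem2p11 (R : comPzRingType) :
  coherent (polynomial_ring R) ->
  Gwdim (polynomial_ring R) = (Gwdim R + 1)%E.
Proof.
(* If 1 = 0, the polynomial ring is R itself and the equality reads -oo = -oo + 1. *)
rewrite /polynomial_ring; case: pselect => [h|/negP h] _; last first.
  by rewrite Gwdim_trivial //; apply/eqP; rewrite -[_ == _]negbK.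
by rewrite Gwdim_poly nontrivial_ringK.
Qed.
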